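(* Let $\alpha_i,\beta_i,\gamma_i$ ($i=1,2,3$) be real numbers such that $$\operatorname{Rank}\begin{pmatrix}\alpha_1&\beta_1&\gamma_1&0&0&0\\ \alpha_2&\beta_2&\gamma_2&0&0&0\\ 0&0&0&\alpha_3&\beta_3&\gamma_3\end{pmatrix}=3,$$ and let $B_1[u]=\alpha_1u(0)+\beta_1u'(0)+\gamma_1u''(0)$, $B_2[u]=\alpha_2u(0)+\beta_2u'(0)+\gamma_2u''(0)$, $B_3[u]=\alpha_3u(1)+\beta_3u'(1)+\gamma_3u''(1)$. Assume the problem $u'''=\varphi$ on $(0,1)$, $B_1[u]=B_2[u]=B_3[u]=0$ has a Green function $G(t,s)$, and that $G$ and $G_1=\partial G/\partial t$ each have constant sign on $[0,1]^2$. Let $G_2=\partial^2G/\partial t^2$ and $$M_0=\max_{0\le t\le1}\int_0^1|G(t,s)|ds,\quad M_1=\max_{0\le t\le1}\int_0^1|G_1(t,s)|ds,\quad M_2=\max_{0\le t\le1}\int_0^1|G_2(t,s)|ds.$$ For $M>0$ let $$\mathcal{D}_M^+=\{(t,x,y,z): 0\le t\le1,\ 0\le x\le M_0M,\ 0\le\sigma(G)\sigma(G_1)y\le M_1M,\ |z|\le M_2M\}.$$ Suppose there exists $M>0$ such that $f(t,x,y,z)$ is continuous and $0\le\sigma(G)f(t,x,y,z)\le M$ for all $(t,x,y,z)\in\mathcal{D}_M^+$. Then the problem $$u'''(t)=f(t,u(t),u'(t),u''(t)),\ 0<t<1,\qquad B_1[u]=B_2[u]=B_3[u]=0$$ has a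 monotone nonnegative solution $u$ satisfying, for all $0\le t\le 1$, $$0\le u(t)\le M_0M,\quad 0\le\sigma(G)\sigma(G_1)u'(t)\le M_1M,\quad |u''(t)|\le M_2M.$$ In addition, if $\sigma(G)\sigma(G_1)=1$ then the problem has a nonnegative increasing solution, and if $\sigma(G)\sigma(G_1)=-1$ then the problem has a nonnegative decreasing solution.
   Context: The Green function $G(t,s)$ of the linear problem $u'''=\varphi$, $B_1[u]=B_2[u]=B_3[u]=0$ is the function on $[0,1]^2$ such that for every $\varphi\in C[0,1]$ the unique solution is $u(t)=\int_0^1G(t,s)\varphi(s)ds$. For a function $H$ of constant sign on $[0,1]^2$, $\sigma(H)=1$ if $H\ge0$ there and $\sigma(H)=-1$ if $H\le0$ there. *)

(* Defs.v *)
From Stdlib Require Import Reals.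
From Coquelicot Require Import Coquelicot.
From mathcomp Require Import all_boot all_algebra.
From mathcomp Require Import Rstruct.

Set Implicit Arguments.
Unset Strict Implicit.
Unset Printing Implicit Defensive.

Definition bc_matrix (a1 b1 c1 a2 b2 c2 a3 b3 c3 : R) : 'M[R]_(3,6) :=
  \matrix_(i < 3, j < 6)
    nth 0%R (nth [::] [:: [:: a1; b1; c1; 0%R; 0%R; 0%R];
                          [:: a2; b2; c2; 0%R; 0%R; 0%R];
                          [:: 0%R; 0%R; 0%R; a3; b3; c3]] i) j.

Definition bc_rank3 (a1 b1 c1 a2 b2 c2 a3 b3 c3 : R) : Prop :=
  \rank (bc_matrix a1 b1 c1 a2 b2 c2 a3 b3 c3) = 3%N.

Open Scope R_scope.

Definition derive01 (f : R -> R) (t l : R) : Prop :=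
  filterlim (fun h => (f (t + h) - f t) / h)
    (within (fun h => h <> 0 /\ 0 <= t + h <= 1) (locally 0)) (locally l).

Definition cont01 (phi : R -> R) : Prop :=
  forall t, 0 <= t <= 1 ->
    filterlim phi (within (fun x => 0 <= x <= 1) (locally t)) (locally (phi t)).

Definition is_sol3 (F : R -> R -> R -> R -> R)
    (a1 b1 c1 a2 b2 c2 a3 b3 c3 : R) (u u1 u2 : R -> R) : Prop :=
  (forall t, 0 <= t <= 1 -> derive01 u t (u1 t) /\ derive01 u1 t (u2 t)) /\
  (forall t, 0 < t < 1 -> is_derive u2 t (F t (u t) (u1 t) (u2 t))) /\
  a1 * u 0 + b1 * u1 0 + c1 * u2 0 = 0 /\
  a2 * u 0 + b2 * u1 0 + c2 * u2 0 = 0 /\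
  a3 * u 1 + b3 * u1 1 + c3 * u2 1 = 0.

(* G is the Green function of u''' = phi, B1[u]=B2[u]=B3[u]=0:
   for every phi in C[0,1] the problem has a solution, and every solution
   (hence the unique one) is u(t) = int_0^1 G(t,s) phi(s) ds on [0,1]. *)
Definition is_green (a1 b1 c1 a2 b2 c2 a3 b3 c3 : R) (G : R -> R -> R) : Prop :=
  forall phi : R -> R, cont01 phi ->
    (exists u u1 u2,
        is_sol3 (fun t _ _ _ => phi t) a1 b1 c1 a2 b2 c2 a3 b3 c3 u u1 u2) /\
    (forall u u1 u2,
        is_sol3 (fun t _ _ _ => phi t) a1 b1 c1 a2 b2 c2 a3 b3 c3 u u1 u2 ->
        forall t, 0 <= t <= 1 -> is_RInt (fun s => G t s * phi s) 0 1 (u t)).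

Definition sign_of (H : R -> R -> R) (sg : R) : Prop :=
  (sg = 1 /\ forall t s, 0 <= t <= 1 -> 0 <= s <= 1 -> 0 <= H t s) \/
  (sg = -1 /\ forall t s, 0 <= t <= 1 -> 0 <= s <= 1 -> H t s <= 0).

Definition is_max_int (H : R -> R -> R) (m : R) : Prop :=
  (forall t, 0 <= t <= 1 -> ex_RInt (fun s => Rabs (H t s)) 0 1) /\
  (exists t0, 0 <= t0 <= 1 /\ RInt (fun s => Rabs (H t0 s)) 0 1 = m) /\
  (forall t, 0 <= t <= 1 -> RInt (fun s => Rabs (H t s)) 0 1 <= m).

Definition DMplus (M0 M1 M2 sG sG1 M t x y z : R) : Prop :=
  0 <= t <= 1 /\ 0 <= x <= M0 * M /\ 0 <= sG * sG1 * y <= M1 * M /\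
  Rabs z <= M2 * M.

Definition cont_on4 (D : R -> R -> R -> R -> Prop) (f : R -> R -> R -> R -> R) : Prop :=
  forall t x y z, D t x y z -> forall eps, 0 < eps -> exists delta, 0 < delta /\
    forall t' x' y' z', D t' x' y' z' ->
      Rabs (t' - t) < delta -> Rabs (x' - x) < delta ->
      Rabs (y' - y) < delta -> Rabs (z' - z) < delta ->
      Rabs (f t' x' y' z' - f t x y z) < eps.

(* Main.v *)
(** Since [B1] and [B2] both act at [0], the solutions of the linear conditions at
    [0] form a line [c v], so the nonlinear problem is solved by shooting in a single
    real parameter and Schauder's theorem is not needed.  After composing [f] with the
    projection onto [DMplus] it is bounded and continuous; a Taylor-Euler scheme
    depends continuously on [c], its value of [B3] is [c B3(w) + O(1)] with
    [B3(w) <> 0], so the intermediate value theorem gives a bounded [c] for each mesh.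
    Pointwise limits along an ultrafilter, as the mesh tends to [0], solve the
    projected problem.

    It remains to see that this solution stays in [DMplus].  [G] is only known through
    its integrals against continuous functions, so for each [t] it may differ from the
    explicit Green function [g] on a small set of [s].  Testing against bump functions
    shows that [G - g] is small on some subinterval of every interval, and a Baire
    argument provides a dense set of [s] with [G(t,s) = g(t,s)] for all [t], hence also
    with equal [t]-derivatives.  Inequalities between Riemann integrals only have to be
    checked on a dense set, which yields the bounds on [u], [u'] and [u'']. *)

Require Import Defs.
From Stdlib Require Import Reals Lra Lia ZArith Cantor Classical ClassicalEpsilon.
From Coquelicot Require Import Coquelicot.
From mathcomp.classical Require filter.
Open Scope R_scope.

(** * Limits along an ultrafilter on the natural numbers *)

(** Along such a [U] every bounded real sequence converges, so the grid functions get limits at all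
    times at once, with no extraction of subsequences. *)
Lemma nat_ultrafilter : exists U : (nat -> Prop) -> Prop,
  ProperFilter U /\ (forall P, eventually P -> U P) /\
  (forall P, U P \/ U (fun n => ~ P n)).
Proof.
  (* The filter classes of MathComp and Coquelicot differ: [eventually] is rebuilt for the first,
     where the ultrafilter lemma lives, and [U] is carried back to the second. *)
  assert (HE : filter.ProperFilter eventually).
  { constructor.
    - intros [N HN]; exact (HN N (le_n N)).
    - constructor.
      + now exists 0%nat.
      + intros P Q; apply filter_and.
      + intros P Q HPQ; now apply filter_imp. }
  destruct (filter.ultraFilterLemma HE) as [U [HU HUE]].
  pose proof (filter.ultra_proper : filter.ProperFilter U) as HP.
  pose proof (filter.filter_filter : filter.Filter U) as HF.
  exists U; split; [|split].
  - constructor.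
    + intros P HPU; apply NNPP; intros Hno.
      apply (filter.filter_not_empty U).
      refine (@filter.filterS _ _ HF P _ _ HPU).
      intros n Hn; apply Hno; now exists n.
    + constructor.
      * exact (@filter.filterT _ _ HF).
      * intros P Q H1 H2; exact (@filter.filterI _ _ HF P Q H1 H2).
      * intros P Q H1 H2; exact (@filter.filterS _ _ HF P Q H1 H2).
  - exact HUE.
  - intros P; exact (filter.in_ultra_setVsetC P HU).
Qed.

Definition ulim (U : (nat -> Prop) -> Prop) (u : nat -> R) (l : R) : Prop :=
  forall eps, 0 < eps -> U (fun n => Rabs (u n - l) < eps).

(** The limit is the supremum of the [x] that lie below [u n] for [U]-many [n]. The dichotomy of [U]
    gives the upper estimate: otherwise [l + eps] would belong to that set. *)
Lemma ulim_bounded U (u : nat -> R) L :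
  ProperFilter U -> (forall P, U P \/ U (fun n => ~ P n)) ->
  (forall n, Rabs (u n) <= L) -> exists l, ulim U u l.
Proof.
  intros HU Hult Hb.
  destruct (completeness (fun x => U (fun n => x <= u n))) as [l [Hl1 Hl2]].
  - exists L; intros x Hx.
    destruct (filter_ex _ Hx) as [n Hn].
    specialize (Hb n); apply Rabs_le_between in Hb; lra.
  - exists (- L); apply filter_forall; intros n.
    specialize (Hb n); apply Rabs_le_between in Hb; lra.
  - exists l; intros eps Heps.
    assert (H1 : U (fun n => l - eps < u n)).
    { destruct (classic (U (fun n => l - eps < u n))) as [H|H]; [assumption|].
      exfalso.
      assert (l <= l - eps); [|lra].
      apply Hl2; intros x Hx.
      destruct (Rle_lt_dec x (l - eps)) as [|Hlt]; [assumption|].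
      exfalso; apply H; revert Hx; apply filter_imp; intros n; lra. }
    destruct (Hult (fun n => l + eps <= u n)) as [H2|H2].
    + specialize (Hl1 _ H2); lra.
    + generalize (filter_and _ _ H1 H2); apply filter_imp.
      intros n [H3 H4]; apply Rabs_lt_between; lra.
Qed.

Lemma ulim_unique U (u : nat -> R) l m :
  ProperFilter U -> ulim U u l -> ulim U u m -> l = m.
Proof.
  intros HU Hl Hm; apply Rminus_diag_uniq, Rabs_eq_0.
  apply Rle_antisym; [|apply Rabs_pos].
  apply le_epsilon; intros eps Heps; rewrite Rplus_0_l.
  pose proof (@filter_and _ U _ _ _ (Hl (eps / 2) ltac:(lra))
    (Hm (eps / 2) ltac:(lra))) as P.
  destruct (filter_ex _ P) as [n [H1 H2]].
  replace (l - m) with (- (u n - l) + (u n - m)) by ring.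
  eapply Rle_trans; [apply Rabs_triang|]; rewrite Rabs_Ropp; lra.
Qed.

Lemma ulim_linear U (u v w : nat -> R) l m p a b c :
  ProperFilter U -> ulim U u l -> ulim U v m -> ulim U w p ->
  ulim U (fun n => a * u n + b * v n + c * w n) (a * l + b * m + c * p).
Proof.
  intros HU Hu Hv Hw eps Heps.
  set (K := Rabs a + Rabs b + Rabs c + 1).
  assert (HK : 0 < K) by
    (unfold K; pose proof (Rabs_pos a); pose proof (Rabs_pos b);
     pose proof (Rabs_pos c); lra).
  assert (He : 0 < eps / K) by now apply Rdiv_lt_0_compat.
  generalize (@filter_and _ U _ _ _ (Hu _ He)
    (@filter_and _ U _ _ _ (Hv _ He) (Hw _ He))).
  apply filter_imp; intros n [H1 [H2 H3]].
  replace (a * u n + b * v n + c * w n - (a * l + b * m + c * p))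
    with (a * (u n - l) + (b * (v n - m) + c * (w n - p))) by ring.
  eapply Rle_lt_trans; [apply Rabs_triang|].
  eapply Rle_lt_trans; [apply Rplus_le_compat_l, Rabs_triang|].
  rewrite (Rabs_mult a), (Rabs_mult b), (Rabs_mult c).
  pose proof (Rmult_le_compat_l _ _ _ (Rabs_pos a) (Rlt_le _ _ H1)).
  pose proof (Rmult_le_compat_l _ _ _ (Rabs_pos b) (Rlt_le _ _ H2)).
  pose proof (Rmult_le_compat_l _ _ _ (Rabs_pos c) (Rlt_le _ _ H3)).
  assert (eps = K * (eps / K)) by (field; lra).
  unfold K in *; lra.
Qed.

(** * Differentiability on the unit interval and limits of difference schemes *)

(** The derivative relative to the unit interval with the quotient multiplied out: [t' = t] is
    harmless, and at [0] and [1] the condition is one-sided. *)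
Definition diff01 (f : R -> R) (t l : R) : Prop :=
  forall eps, 0 < eps -> exists d, 0 < d /\
    forall t', 0 <= t' <= 1 -> Rabs (t' - t) < d ->
      Rabs (f t' - f t - (t' - t) * l) <= eps * Rabs (t' - t).

Lemma derive01_diff01 f t l : derive01 f t l <-> diff01 f t l.
Proof.
  unfold derive01; rewrite filterlim_locally; split.
  - intros H eps Heps.
    destruct (H (mkposreal eps Heps)) as [d Hd].
    exists d; split; [apply cond_pos|]; intros t' Ht' Hlt.
    destruct (Req_dec t' t) as [->|Hne].
    + rewrite !Rminus_diag, Rmult_0_l, Rminus_0_r, Rabs_R0; lra.
    + specialize (Hd (t' - t)).
      assert (Hb : ball 0 d (t' - t)).
      { change (Rabs (t' - t - 0) < d); now rewrite Rminus_0_r. }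
      specialize (Hd Hb).
      assert (Hin : t' - t <> 0 /\ 0 <= t + (t' - t) <= 1) by (split; lra).
      specialize (Hd Hin).
      change (Rabs ((f (t + (t' - t)) - f t) / (t' - t) - l) < eps) in Hd.
      replace (t + (t' - t)) with t' in Hd by ring.
      replace (f t' - f t - (t' - t) * l)
        with (((f t' - f t) / (t' - t) - l) * (t' - t)) by (field; lra).
      rewrite Rabs_mult; apply Rmult_le_compat_r; [apply Rabs_pos|lra].
  - intros H eps.
    destruct (H (eps / 2)) as [d [Hd1 Hd2]]; [destruct eps; simpl; lra|].
    exists (mkposreal d Hd1); intros h Hb [Hh0 Hh1].
    change (Rabs (h - 0) < d) in Hb; rewrite Rminus_0_r in Hb.
    change (Rabs ((f (t + h) - f t) / h - l) < eps).
    specialize (Hd2 (t + h) Hh1).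
    assert (E : t + h - t = h :> R) by (simpl in h; ring).
    rewrite E in Hd2; specialize (Hd2 Hb).
    replace ((f (t + h) - f t) / h - l) with ((f (t + h) - f t - h * l) / h)
      by (field; lra).
    unfold Rdiv; rewrite Rabs_mult, Rabs_inv.
    assert (Hp : 0 < Rabs h) by now apply Rabs_pos_lt.
    apply Rle_lt_trans with (eps / 2); [|destruct eps; simpl; lra].
    apply Rmult_le_reg_r with (Rabs h); [assumption|].
    rewrite Rmult_assoc, Rinv_l, Rmult_1_r by lra; lra.
Qed.

Lemma diff01_is_derive f t l : 0 < t < 1 -> diff01 f t l -> is_derive f t l.
Proof.
  intros Ht H; apply is_derive_Reals; intros eps Heps.
  destruct (H (eps / 2)) as [d [Hd1 Hd2]]; [lra|].
  assert (Hm : 0 < Rmin d (Rmin t (1 - t))) by (repeat apply Rmin_glb_lt; lra).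
  exists (mkposreal _ Hm); simpl; intros h Hh0 Hh.
  pose proof (Rmin_l d (Rmin t (1 - t))).
  pose proof (Rmin_r d (Rmin t (1 - t))).
  pose proof (Rmin_l t (1 - t)); pose proof (Rmin_r t (1 - t)).
  assert (Hh2 : Rabs h < t /\ Rabs h < 1 - t /\ Rabs h < d) by (repeat split; lra).
  destruct Hh2 as [A1 [A2 A3]].
  apply Rabs_lt_between in A1; apply Rabs_lt_between in A2.
  specialize (Hd2 (t + h) ltac:(lra)).
  replace (t + h - t) with h in Hd2 by ring.
  specialize (Hd2 A3).
  replace ((f (t + h) - f t) / h - l) with ((f (t + h) - f t - h * l) / h)
    by (field; lra).
  unfold Rdiv; rewrite Rabs_mult, Rabs_inv.
  assert (Hp : 0 < Rabs h) by now apply Rabs_pos_lt.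
  apply Rle_lt_trans with (eps / 2); [|lra].
  apply Rmult_le_reg_r with (Rabs h); [assumption|].
  rewrite Rmult_assoc, Rinv_l, Rmult_1_r by lra; lra.
Qed.

(** A discrete mean value inequality: the one-step errors [h * (q i - A)] are summed. *)
Lemma increments_bound (s q : nat -> R) h A e j k :
  0 <= h -> (j <= k)%nat ->
  (forall i, (j <= i < k)%nat -> s (S i) = s i + h * q i /\ Rabs (q i - A) <= e) ->
  Rabs (s k - s j - (INR k * h - INR j * h) * A) <= e * (INR k * h - INR j * h).
Proof.
  intros Hh Hjk; induction Hjk as [|k Hjk IH]; intros H.
  - rewrite !Rminus_diag, Rmult_0_l, Rmult_0_r, Rminus_0_r, Rabs_R0; lra.
  - destruct (H k ltac:(lia)) as [-> Hq].
    specialize (IH ltac:(intros i Hi; apply H; lia)).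
    rewrite S_INR.
    replace (s k + h * q k - s j - ((INR k + 1) * h - INR j * h) * A)
      with ((s k - s j - (INR k * h - INR j * h) * A) + h * (q k - A)) by ring.
    eapply Rle_trans; [apply Rabs_triang|].
    rewrite (Rabs_mult h), (Rabs_pos_eq h) by assumption.
    pose proof (Rmult_le_compat_l h _ _ Hh Hq); lra.
Qed.

Lemma increments_bound_sym (s q : nat -> R) h A e j k :
  0 <= h ->
  (forall i, (Nat.min j k <= i < Nat.max j k)%nat ->
     s (S i) = s i + h * q i /\ Rabs (q i - A) <= e) ->
  Rabs (s k - s j - (INR k * h - INR j * h) * A)
    <= e * Rabs (INR k * h - INR j * h).
Proof.
  intros Hh H; destruct (Nat.le_ge_cases j k) as [Hjk|Hjk].
  - rewrite (Rabs_pos_eq (INR k * h - INR j * h)).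
    + apply increments_bound with q; try assumption.
      intros i Hi; apply H; lia.
    + apply le_INR in Hjk.
      pose proof (Rmult_le_compat_r h _ _ Hh Hjk); lra.
  - rewrite (Rabs_minus_sym (INR k * h)), (Rabs_pos_eq (INR j * h - INR k * h)).
    + rewrite <- Rabs_Ropp.
      replace (- (s k - s j - (INR k * h - INR j * h) * A))
        with (s j - s k - (INR j * h - INR k * h) * A) by ring.
      apply increments_bound with q; try assumption.
      intros i Hi; apply H; lia.
    + apply le_INR in Hjk.
      pose proof (Rmult_le_compat_r h _ _ Hh Hjk); lra.
Qed.

(** * Uniform meshes of the unit interval *)

Definition mesh (n : nat) : R := / INR (S n).

(** The index of the last mesh point not after [t], for [0 <= t]. It is exact at [0] and [1], so
    boundary conditions pass to the limit without error. *)
Definition node (n : nat) (t : R) : nat := Z.to_nat (Int_part (t * INR (S n))).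

Lemma mesh_pos n : 0 < mesh n.
Proof. apply Rinv_0_lt_compat, lt_0_INR; lia. Qed.

Lemma mesh_last n : INR (S n) * mesh n = 1.
Proof. apply Rinv_r, not_0_INR; lia. Qed.

Lemma mesh_le_1 n : mesh n <= 1.
Proof.
  pose proof (mesh_last n); pose proof (mesh_pos n).
  assert (1 <= INR (S n)) by (rewrite S_INR; pose proof (pos_INR n); lra); nra.
Qed.

Lemma node_spec n t : 0 <= t ->
  INR (node n t) * mesh n <= t < INR (node n t) * mesh n + mesh n.
Proof.
  intros Ht; unfold node.
  assert (HN : 0 < INR (S n)) by (apply lt_0_INR; lia).
  assert (H0 : 0 <= t * INR (S n)) by (apply Rmult_le_pos; lra).
  destruct (base_Int_part (t * INR (S n))) as [H1 H2].
  assert (Hz : (0 <= Int_part (t * INR (S n)))%Z).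
  { apply Z.lt_succ_r, lt_IZR; rewrite succ_IZR; lra. }
  rewrite INR_IZR_INZ, Z2Nat.id by assumption.
  pose proof (mesh_pos n) as Hm; pose proof (mesh_last n) as Hl.
  assert (E : t = t * INR (S n) * mesh n) by (rewrite Rmult_assoc, Hl; ring).
  rewrite E at 2 3; nra.
Qed.

Lemma node_le n t : 0 <= t <= 1 -> (node n t <= S n)%nat.
Proof.
  intros Ht; apply INR_le.
  destruct (node_spec n t) as [H _]; [lra|].
  pose proof (mesh_pos n); pose proof (mesh_last n).
  apply Rmult_le_reg_r with (mesh n); lra.
Qed.

Lemma node_0 n : node n 0 = 0%nat.
Proof.
  destruct (node_spec n 0) as [H _]; [lra|].
  pose proof (mesh_pos n).
  destruct (node n 0) as [|k]; [reflexivity|].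
  rewrite S_INR in H; pose proof (pos_INR k); nra.
Qed.

Lemma node_1 n : node n 1 = S n.
Proof.
  apply Nat.le_antisymm; [apply node_le; lra|].
  destruct (node_spec n 1) as [_ H]; [lra|].
  pose proof (mesh_pos n) as Hm; pose proof (mesh_last n) as Hl.
  apply Nat.lt_succ_r, INR_lt; rewrite (S_INR (node n 1)).
  apply Rmult_lt_reg_r with (mesh n); lra.
Qed.

Lemma mesh_small (U : (nat -> Prop) -> Prop) eps :
  (forall P, eventually P -> U P) -> 0 < eps -> U (fun n => mesh n < eps).
Proof.
  intros HU Heps; apply HU.
  destruct (nfloor_ex (/ eps)) as [N HN]; [left; now apply Rinv_0_lt_compat|].
  exists N; intros n Hn; unfold mesh.
  rewrite <- (Rinv_inv eps); apply Rinv_lt_contravar.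
  - apply Rmult_lt_0_compat; [now apply Rinv_0_lt_compat|apply lt_0_INR; lia].
  - rewrite S_INR; apply le_INR in Hn; lra.
Qed.

Section GridLimit.

Variables (U : (nat -> Prop) -> Prop) (HU : ProperFilter U).
Hypothesis HUev : forall P, eventually P -> U P.
Variables (s q : nat -> nat -> R) (L : R).
Hypothesis Hs : forall n i, s n (S i) = s n i + mesh n * q n i.
Hypothesis Hq : forall n i, (i <= S n)%nat -> Rabs (q n i) <= L.

Lemma grid_lipschitz n i j : (i <= S n)%nat -> (j <= S n)%nat ->
  Rabs (s n i - s n j) <= L * Rabs (INR i * mesh n - INR j * mesh n).
Proof.
  intros Hi Hj.
  replace (s n i - s n j)
    with (s n i - s n j - (INR i * mesh n - INR j * mesh n) * 0) by ring.
  apply increments_bound_sym with (q n); [left; apply mesh_pos|].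
  intros k Hk; split; [apply Hs|].
  rewrite Rminus_0_r; apply Hq; lia.
Qed.

(** The Lipschitz constant [L] does not depend on the mesh, so convergence at the single node of [t]
    controls all nodes near [t]. *)
Lemma grid_near t l : 0 <= t <= 1 -> ulim U (fun n => s n (node n t)) l ->
  forall eta, 0 < eta -> exists d, 0 < d /\
    U (fun n => forall i, (i <= S n)%nat -> Rabs (INR i * mesh n - t) < d ->
         Rabs (s n i - l) < eta).
Proof.
  intros Ht Hl eta Heta.
  assert (HL : 0 <= L).
  { eapply Rle_trans; [apply Rabs_pos|apply (Hq 0 0); lia]. }
  (* Once [mesh n < d], a mesh point within [d] of [t] is within [2 * d] of the node of [t]. This
     costs at most [eta / 2], and convergence at the node costs the other half. [L + 1] is positive
     even if [L = 0]. *)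
  exists (eta / (4 * (L + 1))); split; [apply Rdiv_lt_0_compat; lra|].
  set (d := eta / (4 * (L + 1))).
  assert (Hd : 0 < d) by (apply Rdiv_lt_0_compat; lra).
  assert (HdL : L * (2 * d) <= eta / 2).
  { assert (d * (4 * (L + 1)) = eta) by (unfold d; field; lra); nra. }
  generalize (filter_and _ _ (mesh_small U d HUev Hd) (Hl (eta / 2) ltac:(lra))).
  apply filter_imp; intros n [Hm Hn] i Hi Hit.
  pose proof (grid_lipschitz n i (node n t) Hi (node_le n t Ht)) as Hlip.
  destruct (node_spec n t) as [N1 N2]; [lra|].
  assert (Hc : Rabs (INR i * mesh n - INR (node n t) * mesh n) <= 2 * d).
  { apply Rabs_lt_between in Hit; apply Rabs_le_between; lra. }
  pose proof (Rmult_le_compat_l L _ _ HL Hc).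
  replace (s n i - l) with ((s n i - s n (node n t)) + (s n (node n t) - l)) by ring.
  eapply Rle_lt_trans; [apply Rabs_triang|]; lra.
Qed.

Variable sl : R -> R.
Hypothesis Hsl : forall t, 0 <= t <= 1 -> ulim U (fun n => s n (node n t)) (sl t).

(** If the slopes near [t] are close to [A] for [U]-many meshes, the discrete mean value inequality
    bounds the increments, and the bound survives in the limit. No integral equation is involved. *)
Lemma grid_diff01 t A : 0 <= t <= 1 ->
  (forall eps, 0 < eps -> exists d, 0 < d /\
     U (fun n => forall i, (i <= S n)%nat -> Rabs (INR i * mesh n - t) < d ->
          Rabs (q n i - A) < eps)) ->
  diff01 sl t A.
Proof.
  intros Ht H eps Heps.
  destruct (H eps Heps) as [d [Hd HUd]].
  (* All nodes between those of [t] and [t'] lie within [d / 2] plus one mesh width of [t], and the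
     mesh is taken below [d / 2]. *)
  exists (d / 2); split; [lra|]; intros t' Ht' Htt.
  (* With [t] and [t'] fixed, [eta] is spent in thirds: on convergence at [t], on convergence at
     [t'], and on moving both times to their nodes, which costs at most [mesh n * K]. *)
  apply le_epsilon; intros eta Heta.
  set (K := Rabs A + eps).
  assert (HK : 0 < K) by (unfold K; pose proof (Rabs_pos A); lra).
  assert (Hd2 : 0 < Rmin (d / 2) (eta / 3 / K)).
  { apply Rmin_glb_lt; [lra|apply Rdiv_lt_0_compat; lra]. }
  pose proof (filter_and _ _ HUd (mesh_small U _ HUev Hd2)) as P1.
  pose proof (@filter_and _ U _ _ _ (Hsl t Ht (eta / 3) ltac:(lra))
    (Hsl t' Ht' (eta / 3) ltac:(lra))) as P2.
  destruct (filter_ex _ (filter_and _ _ P1 P2)) as [n [[Hn Hm] [Hn1 Hn2]]].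
  pose proof (Rmin_l (d / 2) (eta / 3 / K)).
  pose proof (Rmin_r (d / 2) (eta / 3 / K)).
  pose proof (mesh_pos n) as Hpos.
  assert (HmK : mesh n * K <= eta / 3).
  { apply Rle_trans with (eta / 3 / K * K); [|right; field; lra].
    apply Rmult_le_compat_r; lra. }
  destruct (node_spec n t) as [N1 N2]; [lra|].
  destruct (node_spec n t') as [N3 N4]; [lra|].
  pose proof (node_le n t Ht) as Nt; pose proof (node_le n t' Ht') as Nt'.
  assert (Hinc : Rabs (s n (node n t') - s n (node n t)
      - (INR (node n t') * mesh n - INR (node n t) * mesh n) * A)
      <= eps * Rabs (INR (node n t') * mesh n - INR (node n t) * mesh n)).
  { apply increments_bound_sym with (q n); [lra|].
    intros i Hi; split; [apply Hs|]; left; apply Hn; [lia|].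
    apply Rabs_lt_between in Htt.
    assert (Hi1 : Rmin t t' - mesh n < INR i * mesh n).
    { destruct (Nat.le_ge_cases (node n t) (node n t')) as [Hc|Hc].
      - assert (Hc2 : (node n t <= i)%nat) by lia.
        apply le_INR in Hc2; pose proof (Rmin_l t t'); nra.
      - assert (Hc2 : (node n t' <= i)%nat) by lia.
        apply le_INR in Hc2; pose proof (Rmin_r t t'); nra. }
    assert (Hi2 : INR i * mesh n <= Rmax t t').
    { destruct (Nat.le_ge_cases (node n t) (node n t')) as [Hc|Hc].
      - assert (Hc2 : (i <= node n t')%nat) by lia.
        apply le_INR in Hc2; pose proof (Rmax_r t t'); nra.
      - assert (Hc2 : (i <= node n t)%nat) by lia.
        apply le_INR in Hc2; pose proof (Rmax_l t t'); nra. }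
    unfold Rmin, Rmax in Hi1, Hi2; apply Rabs_lt_between.
    destruct (Rle_dec t t'); lra. }
  set (a := INR (node n t') * mesh n - INR (node n t) * mesh n) in *.
  assert (Ha : Rabs (a - (t' - t)) <= mesh n)
    by (unfold a; apply Rabs_le_between; lra).
  assert (Ha2 : Rabs a <= Rabs (t' - t) + mesh n).
  { replace a with ((t' - t) + (a - (t' - t))) by ring.
    eapply Rle_trans; [apply Rabs_triang|lra]. }
  replace (sl t' - sl t - (t' - t) * A)
    with ((s n (node n t') - s n (node n t) - a * A)
      + ((a - (t' - t)) * A + ((s n (node n t) - sl t)
      + - (s n (node n t') - sl t')))) by ring.
  eapply Rle_trans; [apply Rabs_triang|].
  eapply Rle_trans; [apply Rplus_le_compat_l, Rabs_triang|].
  eapply Rle_trans; [do 2 apply Rplus_le_compat_l; apply Rabs_triang|].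
  rewrite Rabs_Ropp, (Rabs_mult (a - _)).
  pose proof (Rmult_le_compat_r (Rabs A) _ _ (Rabs_pos A) Ha).
  pose proof (Rmult_le_compat_l eps _ _ (Rlt_le _ _ Heps) Ha2).
  unfold K in HmK; lra.
Qed.

End GridLimit.

(** * Shooting with a Taylor-Euler scheme *)

Definition cont4 (F : R -> R -> R -> R -> R) : Prop :=
  forall t x y z eps, 0 < eps -> exists d, 0 < d /\
    forall t' x' y' z', Rabs (t' - t) < d -> Rabs (x' - x) < d ->
      Rabs (y' - y) < d -> Rabs (z' - z) < d ->
      Rabs (F t' x' y' z' - F t x y z) < eps.

Section TaylorEuler.

Variable F : R -> R -> R -> R -> R.

(** States approximate [(u, u', u'')]. The term [h / 2 * z] makes the scheme exact for [F = 0], so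
    that [B3] of the homogeneous solution is the same number on every mesh. *)
Fixpoint euler (h : R) (p : R * R * R) (i : nat) : R * R * R :=
  match i with
  | O => p
  | S k => let '(x, y, z) := euler h p k in
      (x + h * (y + h / 2 * z), y + h * z, z + h * F (INR k * h) x y z)
  end.

Definition eulx h p i := fst (fst (euler h p i)).
Definition euly h p i := snd (fst (euler h p i)).
Definition eulz h p i := snd (euler h p i).

Lemma eulx_S h p i :
  eulx h p (S i) = eulx h p i + h * (euly h p i + h / 2 * eulz h p i).
Proof.
  unfold eulx, euly, eulz; simpl; now destruct (euler h p i) as [[x y] z].
Qed.

Lemma euly_S h p i : euly h p (S i) = euly h p i + h * eulz h p i.
Proof.
  unfold eulx, euly, eulz; simpl; now destruct (euler h p i) as [[x y] z].
Qed.

Lemma eulz_S h p i : eulz h p (S i)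
  = eulz h p i + h * F (INR i * h) (eulx h p i) (euly h p i) (eulz h p i).
Proof.
  unfold eulx, euly, eulz; cbn [euler]; now destruct (euler h p i) as [[x y] z].
Qed.

Variable B : R.
Hypothesis Fcont : cont4 F.
Hypothesis Fbound : forall t x y z, Rabs (F t x y z) <= B.
Variables v0 v1 v2 : R.

Definition ray (c : R) : R * R * R := (c * v0, c * v1, c * v2).

Lemma euler_continuous h i c :
  continuous (fun c => eulx h (ray c) i) c /\
  continuous (fun c => euly h (ray c) i) c /\
  continuous (fun c => eulz h (ray c) i) c.
Proof.
  assert (Hlin : forall (X Y : R -> R) k, continuous X c -> continuous Y c ->
            continuous (fun c => X c + k * Y c) c).
  { intros X Y k HX HY; apply (continuous_plus X (fun c => k * Y c)); [assumption|].
    now apply (continuous_scal_r k Y). }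
  induction i as [|i [HX [HY HZ]]].
  - assert (Hv : forall v, continuous (fun c : R => c * v) c).
    { intros v; apply (continuous_ext (fun c : R => 0 + v * c)).
      - intros r; simpl; ring.
      - apply Hlin; [apply continuous_const|apply continuous_id]. }
    repeat split; apply Hv.
  - assert (HF : continuous (fun c => F (INR i * h) (eulx h (ray c) i)
        (euly h (ray c) i) (eulz h (ray c) i)) c).
    { apply filterlim_locally; intros eps.
      destruct (Fcont (INR i * h) (eulx h (ray c) i) (euly h (ray c) i)
        (eulz h (ray c) i) eps (cond_pos eps)) as [d [Hd HFd]].
      generalize (filter_and _ _ (proj1 (filterlim_locally _ _) HX (mkposreal d Hd))
        (filter_and _ _ (proj1 (filterlim_locally _ _) HY (mkposreal d Hd))
          (proj1 (filterlim_locally _ _) HZ (mkposreal d Hd)))).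
      apply filter_imp; intros c' [H1 [H2 H3]].
      apply HFd; try assumption; rewrite Rminus_diag, Rabs_R0; assumption. }
    split; [|split].
    + apply (continuous_ext (fun c => eulx h (ray c) i
        + h * (euly h (ray c) i + h / 2 * eulz h (ray c) i))).
      * intros; now rewrite eulx_S.
      * apply Hlin; [assumption|]; now apply Hlin.
    + apply (continuous_ext (fun c => euly h (ray c) i + h * eulz h (ray c) i)).
      * intros; now rewrite euly_S.
      * now apply Hlin.
    + apply (continuous_ext (fun c => eulz h (ray c) i + h * F (INR i * h)
        (eulx h (ray c) i) (euly h (ray c) i) (eulz h (ray c) i))).
      * intros; now rewrite eulz_S.
      * now apply Hlin.
Qed.

(* The Taylor step reproduces quadratic polynomials exactly, so the deviation
   from the homogeneous solution is due to [F] alone. *)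
Lemma euler_deviation h c i : 0 <= h <= 1 -> INR i * h <= 1 ->
  Rabs (eulz h (ray c) i - c * v2) <= B * (INR i * h) /\
  Rabs (euly h (ray c) i - c * (v1 + v2 * (INR i * h))) <= B * (INR i * h) /\
  Rabs (eulx h (ray c) i
    - c * (v0 + v1 * (INR i * h) + v2 * (INR i * h) ^ 2 / 2)) <= 2 * B * (INR i * h).
Proof.
  intros Hh.
  assert (HB : 0 <= B) by (eapply Rle_trans; [apply Rabs_pos|apply (Fbound 0 0 0 0)]).
  induction i as [|i IH]; intros Hi.
  - unfold eulx, euly, eulz, ray; simpl; rewrite !Rmult_0_l, !Rmult_0_r.
    repeat split; match goal with |- Rabs ?e <= _ => replace e with 0 by field end;
      rewrite Rabs_R0; apply Rle_refl.
  - rewrite S_INR in *.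
    destruct IH as [Hz [Hy Hx]]; [lra|].
    rewrite eulx_S, euly_S, eulz_S.
    set (x := eulx h (ray c) i) in *; set (y := euly h (ray c) i) in *.
    set (z := eulz h (ray c) i) in *; set (T := INR i * h) in *.
    replace ((INR i + 1) * h) with (T + h) in * by (unfold T; ring).
    pose proof (Fbound T x y z) as HF.
    assert (HT : 0 <= T <= 1).
    { split; [|lra]; apply Rmult_le_pos; [apply pos_INR|lra]. }
    (* As [T <= 1], the earlier deviations of [y] and [z] are at most [B]. One step thus adds at
       most [h * B] to those of [z] and [y] and [2 * h * B] to that of [x], and no exponential
       factor arises. *)
    assert (HBT : B * T <= B) by nra.
    split; [|split].
    + replace (z + h * F T x y z - c * v2)
        with ((z - c * v2) + h * F T x y z) by ring.
      eapply Rle_trans; [apply Rabs_triang|].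
      rewrite Rabs_mult, (Rabs_pos_eq h) by lra; nra.
    + replace (y + h * z - c * (v1 + v2 * (T + h)))
        with ((y - c * (v1 + v2 * T)) + h * (z - c * v2)) by ring.
      eapply Rle_trans; [apply Rabs_triang|].
      rewrite (Rabs_mult h), (Rabs_pos_eq h) by lra; nra.
    + replace (x + h * (y + h / 2 * z)
          - c * (v0 + v1 * (T + h) + v2 * (T + h) ^ 2 / 2))
        with ((x - c * (v0 + v1 * T + v2 * T ^ 2 / 2))
          + (h * (y - c * (v1 + v2 * T)) + h * (h / 2 * (z - c * v2)))) by field.
      eapply Rle_trans; [apply Rabs_triang|].
      eapply Rle_trans; [apply Rplus_le_compat_l, Rabs_triang|].
      rewrite !(Rabs_mult h), (Rabs_mult (h / 2)), (Rabs_pos_eq h),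
        (Rabs_pos_eq (h / 2)) by lra.
      assert (h / 2 * Rabs (z - c * v2) <= B / 2).
      { apply Rle_trans with (1 / 2 * B); [|lra].
        apply Rmult_le_compat; try lra; apply Rabs_pos. }
      assert (h * Rabs (y - c * (v1 + v2 * T)) <= h * B) by nra.
      assert (h * (h / 2 * Rabs (z - c * v2)) <= h * B) by nra.
      lra.
Qed.

(** A bound that does not depend on the mesh, as the limits along the ultrafilter require. *)
Lemma euler_bound C h c i : 0 <= h <= 1 -> INR i * h <= 1 -> Rabs c <= C ->
  let L := C * (Rabs v0 + Rabs v1 + Rabs v2) + 2 * B in
  Rabs (eulx h (ray c) i) <= L /\ Rabs (euly h (ray c) i) <= L /\
  Rabs (eulz h (ray c) i) <= L.
Proof.
  intros Hh Hi Hc L.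
  destruct (euler_deviation h c i Hh Hi) as [Hz [Hy Hx]].
  assert (HB : 0 <= B) by (eapply Rle_trans; [apply Rabs_pos|apply (Fbound 0 0 0 0)]).
  assert (HT : 0 <= INR i * h) by (apply Rmult_le_pos; [apply pos_INR|lra]).
  set (T := INR i * h) in *.
  assert (HBT : B * T <= B) by nra.
  pose proof (Rabs_pos v0); pose proof (Rabs_pos v1); pose proof (Rabs_pos v2).
  assert (K : forall a w b e, Rabs (a - c * w) <= e -> Rabs w <= b -> 0 <= b ->
            Rabs a <= C * b + e).
  { intros a w b e Ha Hw Hb; replace a with (c * w + (a - c * w)) by ring.
    eapply Rle_trans; [apply Rabs_triang|]; rewrite Rabs_mult.
    apply Rplus_le_compat; [|assumption].
    apply Rmult_le_compat; try assumption; apply Rabs_pos. }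
  assert (HT2 : 0 <= T ^ 2 / 2 <= 1) by (simpl; nra).
  assert (W1 : Rabs (v2 * T) <= Rabs v2)
    by (rewrite Rabs_mult, (Rabs_pos_eq T) by lra; nra).
  assert (W2 : Rabs (v1 * T) <= Rabs v1)
    by (rewrite Rabs_mult, (Rabs_pos_eq T) by lra; nra).
  assert (W3 : Rabs (v2 * T ^ 2 / 2) <= Rabs v2).
  { unfold Rdiv; rewrite Rmult_assoc, Rabs_mult, (Rabs_pos_eq (T ^ 2 * / 2)); nra. }
  unfold L; split; [|split].
  - eapply Rle_trans; [apply (K _ _ (Rabs v0 + Rabs v1 + Rabs v2) _ Hx)|]; try lra.
    eapply Rle_trans; [apply Rabs_triang|].
    pose proof (Rabs_triang v0 (v1 * T)); lra.
  - eapply Rle_trans; [apply (K _ _ (Rabs v0 + Rabs v1 + Rabs v2) _ Hy)|]; try lra.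
    eapply Rle_trans; [apply Rabs_triang|]; lra.
  - eapply Rle_trans; [apply (K _ _ (Rabs v0 + Rabs v1 + Rabs v2) _ Hz)|]; lra.
Qed.

Variables a3 b3 c3 : R.

Definition endpoint (n : nat) (c : R) : R :=
  a3 * eulx (mesh n) (ray c) (S n) + b3 * euly (mesh n) (ray c) (S n)
  + c3 * eulz (mesh n) (ray c) (S n).

(** [endpoint n c] differs from [c * D] by at most a constant [K] independent of [n] and [c]. It
    therefore changes sign on an interval independent of [n], which bounds the shooting parameters
    uniformly. *)
Lemma shooting_root :
  let D := a3 * (v0 + v1 + v2 / 2) + b3 * (v1 + v2) + c3 * v2 in
  D <> 0 ->
  { C : R & forall n, { c : R | Rabs c <= C /\ endpoint n c = 0 } }.
Proof.
  intros D HD.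
  assert (HB : 0 <= B) by (eapply Rle_trans; [apply Rabs_pos|apply (Fbound 0 0 0 0)]).
  set (K := 2 * B * Rabs a3 + B * Rabs b3 + B * Rabs c3).
  assert (HK : 0 <= K).
  { unfold K; pose proof (Rabs_pos a3); pose proof (Rabs_pos b3);
    pose proof (Rabs_pos c3); nra. }
  assert (Hdev : forall n c, Rabs (endpoint n c - c * D) <= K).
  { intros n c.
    destruct (euler_deviation (mesh n) c (S n)) as [Hz [Hy Hx]].
    - pose proof (mesh_pos n); pose proof (mesh_le_1 n); lra.
    - rewrite mesh_last; lra.
    - rewrite mesh_last in *.
      set (x := eulx (mesh n) (ray c) (S n)) in *.
      set (y := euly (mesh n) (ray c) (S n)) in *.
      set (z := eulz (mesh n) (ray c) (S n)) in *.
      unfold endpoint, D; fold x y z.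
      replace (a3 * x + b3 * y + c3 * z
          - c * (a3 * (v0 + v1 + v2 / 2) + b3 * (v1 + v2) + c3 * v2))
        with (a3 * (x - c * (v0 + v1 * 1 + v2 * 1 ^ 2 / 2))
          + (b3 * (y - c * (v1 + v2 * 1)) + c3 * (z - c * v2))) by field.
      eapply Rle_trans; [apply Rabs_triang|].
      eapply Rle_trans; [apply Rplus_le_compat_l, Rabs_triang|].
      rewrite (Rabs_mult a3), (Rabs_mult b3), (Rabs_mult c3); unfold K.
      pose proof (Rmult_le_compat_l _ _ _ (Rabs_pos a3) Hx).
      pose proof (Rmult_le_compat_l _ _ _ (Rabs_pos b3) Hy).
      pose proof (Rmult_le_compat_l _ _ _ (Rabs_pos c3) Hz).
      lra. }
  (* Here [e * D = K], so [endpoint n] is nonnegative at [e] and nonpositive at [- e]. The sign of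
     [e] is that of [D], hence the absolute value and the case split at the end. *)
  set (e := K / D); exists (Rabs e); intros n.
  assert (HeD : e * D = K) by (unfold e; field; assumption).
  destruct (IVT_gen (endpoint n) (- e) e 0) as [c [Hc Hc0]].
  - intros c; apply continuity_pt_filterlim.
    destruct (euler_continuous (mesh n) (S n) c) as [HX [HY HZ]].
    apply (continuous_plus (fun c => a3 * eulx (mesh n) (ray c) (S n)
      + b3 * euly (mesh n) (ray c) (S n))).
    + apply (continuous_plus (fun c => a3 * eulx (mesh n) (ray c) (S n)));
        now apply (continuous_scal_r (K := R_AbsRing) (V := R_NormedModule)).
    + now apply (continuous_scal_r (K := R_AbsRing) (V := R_NormedModule)).
  - pose proof (Hdev n (- e)) as H1; pose proof (Hdev n e) as H2.
    apply Rabs_le_between in H1; apply Rabs_le_between in H2.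
    replace (- e * D) with (- K) in H1 by lra.
    split.
    + eapply Rle_trans; [apply Rmin_l|lra].
    + eapply Rle_trans; [|apply Rmax_r]; lra.
  - exists c; split; [|assumption].
    revert Hc; unfold Rmin, Rmax; destruct (Rle_dec (- e) e) as [He|He]; intros Hc.
    + rewrite (Rabs_pos_eq e) by lra; apply Rabs_le_between; lra.
    + rewrite (Rabs_left1 e) by lra; apply Rabs_le_between; lra.
Qed.

End TaylorEuler.

(** The slopes of each grid function are, up to a term of order [mesh n], the next grid function or
    [F] along the grid, so [grid_diff01] applies three times. The derivative of [u2] on the closed
    interval serves to make the right-hand side continuous up to the endpoints. *)
Lemma shooting_solution F B v0 v1 v2 a1 b1 c1 a2 b2 c2 a3 b3 c3 :
  cont4 F -> (forall t x y z, Rabs (F t x y z) <= B) ->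
  a1 * v0 + b1 * v1 + c1 * v2 = 0 -> a2 * v0 + b2 * v1 + c2 * v2 = 0 ->
  a3 * (v0 + v1 + v2 / 2) + b3 * (v1 + v2) + c3 * v2 <> 0 ->
  exists u u1 u2, is_sol3 F a1 b1 c1 a2 b2 c2 a3 b3 c3 u u1 u2 /\
    forall t, 0 <= t <= 1 -> diff01 u2 t (F t (u t) (u1 t) (u2 t)).
Proof.
  intros HFc HFb HB1 HB2 HD.
  destruct (shooting_root F B HFc HFb v0 v1 v2 a3 b3 c3 HD) as [C HC].
  set (c := fun n => proj1_sig (HC n)).
  assert (Hc : forall n, Rabs (c n) <= C) by (intros n; apply (proj2_sig (HC n))).
  assert (Hend : forall n, endpoint F v0 v1 v2 a3 b3 c3 n (c n) = 0)
    by (intros n; apply (proj2_sig (HC n))).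
  clearbody c; clear HC HD.
  set (X := fun n => eulx F (mesh n) (ray v0 v1 v2 (c n))).
  set (Y := fun n => euly F (mesh n) (ray v0 v1 v2 (c n))).
  set (Z := fun n => eulz F (mesh n) (ray v0 v1 v2 (c n))).
  set (L := C * (Rabs v0 + Rabs v1 + Rabs v2) + 2 * B).
  assert (Hm : forall n, 0 <= mesh n <= 1).
  { intros n; pose proof (mesh_pos n); pose proof (mesh_le_1 n); lra. }
  assert (HL : forall n i, (i <= S n)%nat ->
      Rabs (X n i) <= L /\ Rabs (Y n i) <= L /\ Rabs (Z n i) <= L).
  { intros n i Hi.
    apply (euler_bound F B HFb v0 v1 v2 C (mesh n) (c n) i (Hm n)); [|apply Hc].
    rewrite <- (mesh_last n); apply Rmult_le_compat_r; [apply Hm|now apply le_INR]. }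
  destruct nat_ultrafilter as [U [HU [HUev Hult]]].
  assert (Hlim : forall s : nat -> nat -> R,
      (forall n i, (i <= S n)%nat -> Rabs (s n i) <= L) ->
      { sl : R -> R | forall t, 0 <= t <= 1 ->
          ulim U (fun n => s n (node n t)) (sl t) }).
  { intros s Hs.
    apply constructive_indefinite_description.
    (* The condition on [t] sits under the quantifier over [l] so that one choice function serves
       all reals; the value [0] outside the unit interval is a dummy. *)
    assert (Hex : forall t, exists l, 0 <= t <= 1 ->
        ulim U (fun n => s n (node n t)) l).
    { intros t; destruct (classic (0 <= t <= 1)) as [Ht|Ht].
      - destruct (ulim_bounded U (fun n => s n (node n t)) L HU Hult) as [l Hl].
        + intros n; apply Hs; now apply node_le.
        + now exists l.
      - exists 0; tauto. }
    exists (fun t => proj1_sig (constructive_indefinite_description _ (Hex t))).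
    intros t; apply (proj2_sig (constructive_indefinite_description _ (Hex t))). }
  destruct (Hlim X ltac:(apply HL)) as [u Hu].
  destruct (Hlim Y ltac:(apply HL)) as [u1 Hu1].
  destruct (Hlim Z ltac:(apply HL)) as [u2 Hu2].
  set (qX := fun n i => Y n i + mesh n / 2 * Z n i).
  set (qZ := fun n i => F (INR i * mesh n) (X n i) (Y n i) (Z n i)).
  assert (SX : forall n i, X n (S i) = X n i + mesh n * qX n i)
    by (intros; apply eulx_S).
  assert (SY : forall n i, Y n (S i) = Y n i + mesh n * Z n i)
    by (intros; apply euly_S).
  assert (SZ : forall n i, Z n (S i) = Z n i + mesh n * qZ n i)
    by (intros; apply eulz_S).
  assert (HZb : forall n i, (i <= S n)%nat -> Rabs (Z n i) <= L) by apply HL.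
  assert (HqXb : forall n i, (i <= S n)%nat -> Rabs (qX n i) <= 2 * L).
  { intros n i Hi; destruct (HL n i Hi) as [_ [HY HZ]]; unfold qX.
    eapply Rle_trans; [apply Rabs_triang|].
    rewrite Rabs_mult, (Rabs_pos_eq (mesh n / 2)) by (specialize (Hm n); lra).
    specialize (Hm n); pose proof (Rabs_pos (Z n i)); nra. }
  assert (HqZb : forall n i, (i <= S n)%nat -> Rabs (qZ n i) <= B)
    by (intros; apply HFb).
  pose proof (grid_near U HU HUev X qX _ SX HqXb) as NX.
  pose proof (grid_near U HU HUev Y Z _ SY HZb) as NY.
  pose proof (grid_near U HU HUev Z qZ _ SZ HqZb) as NZ.
  assert (DX : forall t, 0 <= t <= 1 -> diff01 u t (u1 t)).
  { intros t Ht; apply (grid_diff01 U HU HUev X qX SX u Hu t (u1 t) Ht).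
    intros eps Heps.
    destruct (NY t (u1 t) Ht (Hu1 t Ht) (eps / 2) ltac:(lra)) as [d [Hd HUd]].
    exists d; split; [assumption|].
    assert (HL0 : 0 < L + 1).
    { pose proof (HZb 0%nat 0%nat ltac:(lia)); pose proof (Rabs_pos (Z 0%nat 0%nat)); lra. }
    generalize (filter_and _ _ HUd (mesh_small U (eps / (L + 1)) HUev
      ltac:(apply Rdiv_lt_0_compat; lra))).
    apply filter_imp; intros n [Hn Hmn] i Hi Hit; unfold qX.
    specialize (Hn i Hi Hit).
    replace (Y n i + mesh n / 2 * Z n i - u1 t)
      with ((Y n i - u1 t) + mesh n / 2 * Z n i) by ring.
    eapply Rle_lt_trans; [apply Rabs_triang|].
    rewrite (Rabs_mult (mesh n / 2)), (Rabs_pos_eq (mesh n / 2))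
      by (specialize (Hm n); lra).
    assert (mesh n * (L + 1) < eps).
    { apply Rlt_le_trans with (eps / (L + 1) * (L + 1)); [|right; field; lra].
      apply Rmult_lt_compat_r; lra. }
    pose proof (HZb n i Hi); pose proof (mesh_pos n); nra. }
  assert (DY : forall t, 0 <= t <= 1 -> diff01 u1 t (u2 t)).
  { intros t Ht; apply (grid_diff01 U HU HUev Y Z SY u1 Hu1 t (u2 t) Ht).
    intros eps Heps; exact (NZ t (u2 t) Ht (Hu2 t Ht) eps Heps). }
  assert (DZ : forall t, 0 <= t <= 1 -> diff01 u2 t (F t (u t) (u1 t) (u2 t))).
  { intros t Ht; apply (grid_diff01 U HU HUev Z qZ SZ u2 Hu2 t _ Ht).
    intros eps Heps.
    destruct (HFc t (u t) (u1 t) (u2 t) eps Heps) as [d [Hd HFd]].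
    destruct (NX t (u t) Ht (Hu t Ht) d Hd) as [d1 [Hd1 HU1]].
    destruct (NY t (u1 t) Ht (Hu1 t Ht) d Hd) as [d2 [Hd2 HU2]].
    destruct (NZ t (u2 t) Ht (Hu2 t Ht) d Hd) as [d3 [Hd3 HU3]].
    exists (Rmin d (Rmin d1 (Rmin d2 d3))); split;
      [repeat apply Rmin_glb_lt; assumption|].
    generalize (filter_and _ _ HU1 (filter_and _ _ HU2 HU3)).
    apply filter_imp; intros n [Hn1 [Hn2 Hn3]] i Hi Hit.
    pose proof (Rmin_l d (Rmin d1 (Rmin d2 d3))).
    pose proof (Rmin_r d (Rmin d1 (Rmin d2 d3))).
    pose proof (Rmin_l d1 (Rmin d2 d3)); pose proof (Rmin_r d1 (Rmin d2 d3)).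
    pose proof (Rmin_l d2 d3); pose proof (Rmin_r d2 d3).
    apply HFd; [lra|apply Hn1|apply Hn2|apply Hn3]; (assumption || lra). }
  (* At time [0] every scheme starts on the ray, where the condition holds exactly, so the limit
     inherits it. *)
  assert (BC0 : forall a b c', a * v0 + b * v1 + c' * v2 = 0 ->
      a * u 0 + b * u1 0 + c' * u2 0 = 0).
  { intros a b c' Habc.
    apply (ulim_unique U (fun n => a * X n (node n 0) + b * Y n (node n 0)
      + c' * Z n (node n 0))); [assumption| |].
    - apply ulim_linear; [assumption|apply Hu|apply Hu1|apply Hu2]; lra.
    - intros eps Heps; apply filter_forall; intros n; rewrite node_0.
      unfold X, Y, Z, eulx, euly, eulz, ray; simpl.
      replace (a * (c n * v0) + b * (c n * v1) + c' * (c n * v2) - 0)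
        with (c n * (a * v0 + b * v1 + c' * v2)) by ring.
      now rewrite Habc, Rmult_0_r, Rabs_R0. }
  exists u, u1, u2; split; [|assumption].
  split; [|split; [|split; [|split]]].
  - intros t Ht; split; apply derive01_diff01; auto.
  - intros t Ht; apply diff01_is_derive; [assumption|]; apply DZ; lra.
  - now apply BC0.
  - now apply BC0.
  - apply (ulim_unique U (fun n => a3 * X n (node n 1) + b3 * Y n (node n 1)
      + c3 * Z n (node n 1))); [assumption| |].
    + apply ulim_linear; [assumption|apply Hu|apply Hu1|apply Hu2]; lra.
    + intros eps Heps; apply filter_forall; intros n; rewrite node_1.
      specialize (Hend n); unfold endpoint in Hend; unfold X, Y, Z.
      now rewrite Hend, Rminus_0_r, Rabs_R0.
Qed.

(** * Riemann integrals and dense sets *)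

Lemma Riemann_sum_ge0 (h : R -> R) (tag : R -> R -> R) (p : list R) :
  sorted Rle p -> (forall x y, x < y -> 0 <= h (tag x y)) ->
  0 <= Riemann_sum h (SF_seq_f2 tag p).
Proof.
  intros Hp Htag; induction p as [|x p IH]; [apply Rle_refl|].
  destruct p as [|y p]; [apply Rle_refl|].
  destruct Hp as [Hxy Hp].
  rewrite SF_cons_f2 by (simpl; apply Nat.lt_0_succ || reflexivity).
  rewrite Riemann_sum_cons; simpl fst; simpl snd.
  apply Rplus_le_le_0_compat; [|now apply IH].
  change (0 <= (y - x) * h (tag x y)).
  destruct Hxy as [Hxy|Hxy].
  - apply Rmult_le_pos; [lra|now apply Htag].
  - rewrite Hxy, Rminus_diag, Rmult_0_l; apply Rle_refl.
Qed.

(** Riemann sums converge to [I] for any choice of tags. With tags taken where [h] is nonnegative,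
    every sum is nonnegative, hence so is [I]. *)
Lemma is_RInt_ge0_dense (h : R -> R) (I : R) : is_RInt h 0 1 I ->
  (forall a b, 0 <= a -> a < b -> b <= 1 -> exists s, a < s < b /\ 0 <= h s) ->
  0 <= I.
Proof.
  intros HI Hdense.
  (* The tag function is defined for all pairs of reals. Setting [h] to [0] outside [(0, 1)] keeps
     the integral and supplies tags in intervals where density says nothing. *)
  set (h' := fun s => if Rlt_dec 0 s then if Rlt_dec s 1 then h s else 0 else 0).
  assert (HI' : is_RInt h' 0 1 I).
  { revert HI; apply is_RInt_ext; intros s.
    rewrite Rmin_left, Rmax_right by lra; intros Hs; unfold h'.
    destruct (Rlt_dec 0 s), (Rlt_dec s 1); lra. }
  assert (Htag : forall x y, exists s, (x <= y -> x <= s <= y) /\ (x < y -> 0 <= h' s)).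
  { intros x y; destruct (Rlt_le_dec x y) as [Hxy|Hxy]; [|exists x; split; lra].
    destruct (Rlt_le_dec (Rmax x 0) (Rmin y 1)) as [Hm|Hm].
    - pose proof (Rmax_l x 0); pose proof (Rmax_r x 0).
      pose proof (Rmin_l y 1); pose proof (Rmin_r y 1).
      destruct (Hdense (Rmax x 0) (Rmin y 1)) as [s [Hs1 Hs2]]; try lra.
      exists s; split; intros _; [lra|]; unfold h'.
      destruct (Rlt_dec 0 s), (Rlt_dec s 1); lra.
    (* Here [(x, y)] does not meet [(0, 1)], so [h'] vanishes at the midpoint. *)
    - exists ((x + y) / 2); split; intros _; [lra|]; unfold h'.
      destruct (Rlt_dec 0 ((x + y) / 2)), (Rlt_dec ((x + y) / 2) 1); try lra.
      exfalso; revert Hm; unfold Rmax, Rmin.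
      destruct (Rle_dec x 0), (Rle_dec y 1); lra. }
  set (tag := fun x y => proj1_sig (constructive_indefinite_description _ (Htag x y))).
  assert (Htag1 : forall x y, x <= y -> x <= tag x y <= y)
    by (intros x y; apply (proj2_sig (constructive_indefinite_description _ (Htag x y)))).
  assert (Htag2 : forall x y, x < y -> 0 <= h' (tag x y))
    by (intros x y; apply (proj2_sig (constructive_indefinite_description _ (Htag x y)))).
  clearbody tag.
  destruct (Rle_lt_dec 0 I) as [|Hneg]; [assumption|exfalso].
  assert (He : 0 < - I) by lra.
  destruct (proj1 (filterlim_locally _ _) HI' (mkposreal _ He)) as [d Hd].
  destruct (nfloor_ex (/ d)) as [n Hn]; [left; apply Rinv_0_lt_compat, cond_pos|].
  destruct (Riemann_fine_unif_part tag 0 1 n Htag1) as [F1 F2]; [lra|].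
  assert (Hlt : (1 - 0) / (INR n + 1) < d).
  { destruct d as [d Hd0]; simpl in *.
    pose proof (pos_INR n).
    assert (H1 : d * / d < d * (INR n + 1)) by (apply Rmult_lt_compat_l; lra).
    rewrite Rinv_r in H1 by lra.
    apply Rmult_lt_reg_r with (INR n + 1); [lra|].
    unfold Rdiv; rewrite Rmult_assoc, Rinv_l by lra; lra. }
  assert (F2' : pointed_subdiv (SF_seq_f2 tag (unif_part 0 1 n)) /\
     SF_h (SF_seq_f2 tag (unif_part 0 1 n)) = Rmin 0 1 /\
     seq.last (SF_h (SF_seq_f2 tag (unif_part 0 1 n)))
       (SF_lx (SF_seq_f2 tag (unif_part 0 1 n))) = Rmax 0 1)
    by (rewrite Rmin_left, Rmax_right by lra; assumption).
  specialize (Hd _ (Rle_lt_trans _ _ _ F1 Hlt) F2').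
  change (Rabs (sign (1 - 0) * Riemann_sum h' (SF_seq_f2 tag (unif_part 0 1 n)) - I)
    < - I) in Hd.
  rewrite sign_eq_1, Rmult_1_l in Hd by lra.
  pose proof (Riemann_sum_ge0 h' tag (unif_part 0 1 n)
    (unif_part_sort 0 1 n ltac:(lra)) Htag2).
  apply Rabs_lt_between in Hd; lra.
Qed.

Lemma is_RInt_le_dense (f g : R -> R) (If Ig : R) :
  is_RInt f 0 1 If -> is_RInt g 0 1 Ig ->
  (forall a b, 0 <= a -> a < b -> b <= 1 -> exists s, a < s < b /\ f s <= g s) ->
  If <= Ig.
Proof.
  intros Hf Hg Hd.
  assert (0 <= Ig - If); [|lra].
  apply is_RInt_ge0_dense with (fun s => g s - f s).
  - now apply (is_RInt_minus g f).
  - intros a b Ha Hab Hb; destruct (Hd a b Ha Hab Hb) as [s [Hs1 Hs2]].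
    exists s; split; [assumption|lra].
Qed.

(** * Bump functions and the Baire argument *)

Definition bump (a b s : R) : R := Rmax 0 ((s - a) * (b - s)).

Lemma continuous_Rmax0 (f : R -> R) x :
  continuous f x -> continuous (fun s => Rmax 0 (f s)) x.
Proof.
  intros Hf; apply (continuous_comp f (Rmax 0)); [assumption|].
  apply (continuous_ext (fun y => (y + Rabs y) / 2)).
  - intros y; unfold Rmax, Rabs; destruct (Rle_dec 0 y), (Rcase_abs y); lra.
  - apply (continuous_scal_l (fun y : R => y + Rabs y) (/ 2)).
    apply (continuous_plus (fun y : R => y) Rabs).
    + apply continuous_id.
    + apply continuous_Rabs.
Qed.

Lemma continuous_bump a b s : continuous (bump a b) s.
Proof.
  apply (continuous_Rmax0 (fun s => (s - a) * (b - s))).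
  apply (ex_derive_continuous (V := R_NormedModule)); auto_derive; exact I.
Qed.

Lemma bump_ge0 a b s : 0 <= bump a b s.
Proof. apply Rmax_l. Qed.

Lemma bump_out a b s : a <= b -> s <= a \/ b <= s -> bump a b s = 0.
Proof. intros Hab Hs; apply Rmax_left; destruct Hs; nra. Qed.

Lemma RInt_bump_pos a b : 0 <= a -> a < b -> b <= 1 -> 0 < RInt (bump a b) 0 1.
Proof.
  intros Ha Hab Hb.
  assert (Hex : forall x y, ex_RInt (bump a b) x y).
  { intros x y; apply (ex_RInt_continuous (bump a b)).
    intros z _; apply continuous_bump. }
  assert (Hge : forall x y, x <= y -> 0 <= RInt (bump a b) x y).
  { intros x y Hxy; apply RInt_ge_0; auto; intros; apply bump_ge0. }
  rewrite <- (RInt_Chasles (bump a b) 0 a 1), <- (RInt_Chasles (bump a b) a b 1)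
    by apply Hex.
  assert (0 < RInt (bump a b) a b).
  { apply RInt_gt_0; [assumption| |intros; apply continuous_bump].
    intros s Hs; unfold bump; rewrite Rmax_right; nra. }
  pose proof (Hge 0 a Ha); pose proof (Hge b 1 Hb).
  change (0 < RInt (bump a b) 0 a + (RInt (bump a b) a b + RInt (bump a b) b 1)); lra.
Qed.

Lemma continuous_cont01 (phi : R -> R) : (forall s, continuous phi s) -> cont01 phi.
Proof.
  intros H t _; eapply filterlim_filter_le_1; [|apply H]; apply filter_le_within.
Qed.

(** Otherwise [d > eps] on a dense subset of [(a, b)], and comparing integrals on a dense set gives
    [eps] times the integral of a bump at most [0]. No regularity of [d] itself is assumed. *)
Lemma not_dense_gt (d : R -> R) (eps a b : R) :
  (forall phi, cont01 phi -> is_RInt (fun s => d s * phi s) 0 1 0) ->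
  0 < eps -> 0 <= a -> a < b -> b <= 1 ->
  exists x y, a <= x /\ x < y /\ y <= b /\ forall s, x < s < y -> d s <= eps.
Proof.
  intros Hd Heps Ha Hab Hb; apply NNPP; intros Hno.
  assert (Hdense : forall x y, a <= x -> x < y -> y <= b ->
            exists s, x < s < y /\ eps < d s).
  { intros x y Hx Hxy Hy; apply NNPP; intros Hn; apply Hno; exists x, y.
    repeat split; try assumption; intros s Hs.
    apply Rnot_lt_le; intros Hlt; apply Hn; now exists s. }
  pose proof (RInt_bump_pos a b Ha Hab Hb) as HI.
  assert (eps * RInt (bump a b) 0 1 <= 0); [|nra].
  apply (is_RInt_le_dense (fun s => eps * bump a b s) (fun s => d s * bump a b s)).
  - apply (is_RInt_scal (bump a b)), (RInt_correct (bump a b)).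
    apply (ex_RInt_continuous (bump a b)); intros; apply continuous_bump.
  - apply Hd, continuous_cont01, continuous_bump.
  - intros x y Hx Hxy Hy.
    (* Either [(x, y)] overlaps [(a, b)], where a point with [d s > eps] is available, or the bump
       vanishes on it. *)
    destruct (Rlt_le_dec (Rmax x a) (Rmin y b)) as [Hm|Hm].
    + pose proof (Rmax_l x a); pose proof (Rmax_r x a).
      pose proof (Rmin_l y b); pose proof (Rmin_r y b).
      destruct (Hdense (Rmax x a) (Rmin y b)) as [s [Hs1 Hs2]]; try lra.
      exists s; split; [lra|]; apply Rmult_le_compat_r; [apply bump_ge0|lra].
    + exists ((x + y) / 2); split; [lra|].
      rewrite bump_out; [lra|lra|].
      revert Hm; unfold Rmax, Rmin; destruct (Rle_dec x a), (Rle_dec y b); lra.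
Qed.

Lemma small_subinterval (d : R -> R) (eps a b : R) :
  (forall phi, cont01 phi -> is_RInt (fun s => d s * phi s) 0 1 0) ->
  0 < eps -> 0 <= a -> a < b -> b <= 1 ->
  exists x y, a < x /\ x < y /\ y < b /\ forall s, x <= s <= y -> Rabs (d s) <= eps.
Proof.
  intros Hd Heps Ha Hab Hb.
  destruct (not_dense_gt d eps a b Hd Heps Ha Hab Hb) as [x [y [Hx [Hxy [Hy H1]]]]].
  destruct (not_dense_gt (fun s => - d s) eps x y) as [x' [y' [Hx' [Hxy' [Hy' H2]]]]];
    try lra.
  - intros phi Hphi.
    apply (is_RInt_ext (fun s => opp (d s * phi s))).
    + intros s _; change (- (d s * phi s) = - d s * phi s); ring.
    + replace 0 with (opp 0) at 2 by apply Ropp_0.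
      apply (is_RInt_opp (fun s => d s * phi s)); auto.
  (* The middle third is a closed interval strictly inside, as the nested intervals of [baire01]
     require. *)
  - exists ((2 * x' + y') / 3), ((x' + 2 * y') / 3).
    repeat split; try lra; intros s Hs; apply Rabs_le_between.
    specialize (H1 s ltac:(lra)); specialize (H2 s ltac:(lra)); lra.
Qed.

(** Nested closed intervals, the one of index [S n] lying in [Q n], share the supremum of their left
    ends. Strict nesting at the first step puts this point in the open interval [(a, b)]. *)
Lemma baire01 (Q : nat -> R -> Prop) :
  (forall n a b, 0 <= a -> a < b -> b <= 1 ->
     exists x y, a < x /\ x < y /\ y < b /\ forall s, x <= s <= y -> Q n s) ->
  forall a b, 0 <= a -> a < b -> b <= 1 -> exists s, a < s < b /\ forall n, Q n s.
Proof.
  intros HQ a b Ha Hab Hb.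
  assert (Hst : forall (n : nat) (p : R * R), exists p' : R * R,
      0 <= fst p -> fst p < snd p -> snd p <= 1 ->
      fst p < fst p' /\ fst p' < snd p' /\ snd p' < snd p /\
      forall s, fst p' <= s <= snd p' -> Q n s).
  { intros n p.
    destruct (classic (0 <= fst p /\ fst p < snd p /\ snd p <= 1)) as [[H1 [H2 H3]]|H].
    - destruct (HQ n _ _ H1 H2 H3) as [x [y H]]; now exists (x, y).
    - exists p; intros; exfalso; tauto. }
  set (step := fun n p => proj1_sig (constructive_indefinite_description _ (Hst n p))).
  assert (Hstep : forall n p, 0 <= fst p -> fst p < snd p -> snd p <= 1 ->
      fst p < fst (step n p) /\ fst (step n p) < snd (step n p) /\
      snd (step n p) < snd p /\
      forall s, fst (step n p) <= s <= snd (step n p) -> Q n s)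
    by (intros n p; apply (proj2_sig (constructive_indefinite_description _ (Hst n p)))).
  clearbody step.
  set (I := fix I n := match n with O => (a, b) | S k => step k (I k) end).
  assert (HI : forall n, 0 <= fst (I n) /\ fst (I n) < snd (I n) /\ snd (I n) <= 1).
  { induction n as [|n [H1 [H2 H3]]]; [simpl; lra|].
    destruct (Hstep n (I n) H1 H2 H3) as [H4 [H5 [H6 _]]]; simpl; lra. }
  assert (HS : forall n, fst (I n) < fst (I (S n)) /\ snd (I (S n)) < snd (I n) /\
      forall s, fst (I (S n)) <= s <= snd (I (S n)) -> Q n s).
  { intros n; destruct (HI n) as [H1 [H2 H3]].
    destruct (Hstep n (I n) H1 H2 H3) as [H4 [H5 [H6 H7]]]; repeat split; assumption. }
  assert (Hmono : forall n m, (n <= m)%nat ->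
      fst (I n) <= fst (I m) /\ snd (I m) <= snd (I n)).
  { intros n m Hnm; induction Hnm as [|m _ IH]; [lra|].
    destruct (HS m) as [H1 [H2 _]]; lra. }
  assert (Hlr : forall n m, fst (I n) <= snd (I m)).
  { intros n m; destruct (Hmono n (Nat.max n m)) as [H1 _]; [lia|].
    destruct (Hmono m (Nat.max n m)) as [_ H2]; [lia|].
    destruct (HI (Nat.max n m)) as [_ [H3 _]]; lra. }
  destruct (completeness (fun x => exists n, x = fst (I n))) as [s [Hs1 Hs2]].
  - exists (snd (I 0%nat)); intros x [n ->]; apply Hlr.
  - now exists (fst (I 0%nat)), 0%nat.
  - assert (Hin : forall n, fst (I n) <= s <= snd (I n)).
    { intros n; split; [apply Hs1; now exists n|].
      apply Hs2; intros x [m ->]; apply Hlr. }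
    exists s; split; [|intros n; now apply (HS n)].
    destruct (HS 0%nat) as [H1 [H2 _]]; specialize (Hin 1%nat).
    change (fst (I 0%nat)) with a in H1; change (snd (I 0%nat)) with b in H2; lra.
Qed.

(** * The explicit Green function *)

Lemma is_derive_diff01 f t l : is_derive f t l -> diff01 f t l.
Proof.
  intros Hf eps Heps; apply is_derive_Reals in Hf.
  destruct (Hf eps Heps) as [d Hd]; exists d; split; [apply cond_pos|].
  intros t' _ Ht'.
  destruct (Req_dec t' t) as [->|Hne].
  - rewrite !Rminus_diag, Rmult_0_l, Rminus_0_r, Rabs_R0; lra.
  - specialize (Hd (t' - t) ltac:(lra) Ht').
    replace (t + (t' - t)) with t' in Hd by ring.
    replace (f t' - f t - (t' - t) * l)
      with (((f t' - f t) / (t' - t) - l) * (t' - t)) by (field; lra).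
    rewrite Rabs_mult; apply Rmult_le_compat_r; [apply Rabs_pos|lra].
Qed.

Lemma diff01_unique f g t l m : 0 <= t <= 1 ->
  (forall r, 0 <= r <= 1 -> f r = g r) -> diff01 f t l -> diff01 g t m -> l = m.
Proof.
  intros Ht Hfg Hf Hg; apply Rminus_diag_uniq, Rabs_eq_0.
  apply Rle_antisym; [|apply Rabs_pos].
  apply le_epsilon; intros eps Heps; rewrite Rplus_0_l.
  destruct (Hf (eps / 2) ltac:(lra)) as [d1 [Hd1 H1]].
  destruct (Hg (eps / 2) ltac:(lra)) as [d2 [Hd2 H2]].
  set (d := Rmin (Rmin d1 d2) 1 / 2).
  assert (Hd : 0 < d /\ d < d1 /\ d < d2 /\ d <= 1 / 2).
  { unfold d, Rmin; destruct (Rle_dec d1 d2); destruct (Rle_dec _ 1); lra. }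
  (* As [d <= 1 / 2], there is room for a step of length [d] away from the nearer endpoint. *)
  assert (Hr : exists r, 0 <= r <= 1 /\ Rabs (r - t) = d).
  { destruct (Rle_lt_dec t (1 / 2)) as [Hc|Hc].
    - exists (t + d); split; [lra|]; rewrite Rabs_pos_eq; lra.
    - exists (t - d); split; [lra|]; rewrite Rabs_left1; lra. }
  destruct Hr as [r [Hr Hrd]].
  specialize (H1 r Hr ltac:(lra)); specialize (H2 r Hr ltac:(lra)).
  rewrite !Hfg in H1 by assumption.
  apply Rmult_le_reg_r with d; [lra|].
  replace (Rabs (l - m) * d) with (Rabs ((r - t) * (l - m)))
    by (rewrite Rabs_mult, Hrd; ring).
  replace ((r - t) * (l - m)) with (- (g r - g t - (r - t) * l)
    + (g r - g t - (r - t) * m)) by ring.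
  eapply Rle_trans; [apply Rabs_triang|]; rewrite Rabs_Ropp, Hrd in *; lra.
Qed.

Lemma is_RInt_lin3 (f g h : R -> R) x y a b c F1 F2 F3 :
  is_RInt f x y F1 -> is_RInt g x y F2 -> is_RInt h x y F3 ->
  is_RInt (fun s => a * f s + b * g s + c * h s) x y (a * F1 + b * F2 + c * F3).
Proof.
  intros Hf Hg Hh.
  apply (is_RInt_plus (fun s => a * f s + b * g s) (fun s => c * h s)).
  - apply (is_RInt_plus (fun s => a * f s) (fun s => b * g s)).
    + now apply (is_RInt_scal f).
    + now apply (is_RInt_scal g).
  - now apply (is_RInt_scal h).
Qed.

Lemma is_RInt_truncated (h H : R -> R) t I : 0 <= t <= 1 ->
  is_RInt h 0 t I -> (forall s, s < t -> H s = h s) ->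
  (forall s, t < s -> H s = 0) -> is_RInt H 0 1 I.
Proof.
  intros Ht HI H1 H2.
  replace I with (plus I (scal (1 - t) 0)).
  - apply is_RInt_Chasles with t.
    + revert HI; apply is_RInt_ext; intros s; rewrite Rmin_left, Rmax_right by lra.
      intros Hs; symmetry; apply H1; lra.
    + apply (is_RInt_ext (fun _ => 0)).
      * intros s; rewrite Rmin_left, Rmax_right by lra.
        intros Hs; symmetry; apply H2; lra.
      * apply (is_RInt_const t 1 0).
  - change (I + (1 - t) * 0 = I); ring.
Qed.

Section ExplicitGreen.

Variables v0 v1 v2 a3 b3 c3 : R.

(* [B3] of the solution with initial data [(v0, v1, v2)] of [u''' = 0]. *)
Let D := a3 * (v0 + v1 + v2 / 2) + b3 * (v1 + v2) + c3 * v2.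
Hypothesis HD : D <> 0.

(* [shoot], the integral of [gker * phi], is the shooting parameter [c] that makes
   [B3] vanish on [c * (v0 + v1 t + v2 t^2 / 2) + int_0^t (t - s)^2 / 2 * phi s ds]. *)
Definition gker (s : R) : R := - (a3 * ((1 - s) ^ 2 / 2) + b3 * (1 - s) + c3) / D.

(** The Cauchy kernel of [u'''], half the squared positive part of [t - s], plus the multiple of the
    homogeneous solution that restores [B3 = 0]. [green1] and [green2] are its [t]-derivatives, the
    latter off the diagonal. *)
Definition green0 (t s : R) : R :=
  (v0 + v1 * t + v2 * (t ^ 2 / 2)) * gker s + Rmax 0 (t - s) ^ 2 / 2.

Definition green1 (t s : R) : R := (v1 + v2 * t) * gker s + Rmax 0 (t - s).

Definition green2 (t s : R) : R := v2 * gker s + if Rlt_dec s t then 1 else 0.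

Lemma diff01_green0 t s : diff01 (fun r => green0 r s) t (green1 t s).
Proof.
  intros eps Heps; unfold green0, green1.
  set (K := Rabs (v2 * gker s / 2) + 1).
  assert (HK : 0 < K) by (unfold K; pose proof (Rabs_pos (v2 * gker s / 2)); lra).
  exists (eps / K); split; [now apply Rdiv_lt_0_compat|]; intros t' _ Ht'.
  replace ((v0 + v1 * t' + v2 * (t' ^ 2 / 2)) * gker s + Rmax 0 (t' - s) ^ 2 / 2 -
     ((v0 + v1 * t + v2 * (t ^ 2 / 2)) * gker s + Rmax 0 (t - s) ^ 2 / 2) -
     (t' - t) * ((v1 + v2 * t) * gker s + Rmax 0 (t - s)))
    with (v2 * gker s / 2 * (t' - t) ^ 2 + (Rmax 0 (t' - s) ^ 2 / 2
      - Rmax 0 (t - s) ^ 2 / 2 - (t' - t) * Rmax 0 (t - s))) by field.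
  (* The squared positive part has a quadratic Taylor remainder even across its kink: when [a] and
     [b] have opposite signs, [(a - b)^2] dominates [a^2], [b^2] and [|a * b|]. Hence [t = s] needs
     no exception. *)
  assert (HR : Rabs (Rmax 0 (t' - s) ^ 2 / 2 - Rmax 0 (t - s) ^ 2 / 2
      - (t' - t) * Rmax 0 (t - s)) <= 1 * (t' - t) ^ 2).
  { apply Rabs_le_between.
    replace (t' - t) with ((t' - s) - (t - s)) by ring.
    generalize (t' - s) (t - s); intros a b; unfold Rmax.
    pose proof (pow2_ge_0 (a - b)); pose proof (pow2_ge_0 a); pose proof (pow2_ge_0 b).
    destruct (Rle_dec 0 a), (Rle_dec 0 b); [split; nra| | |split; nra].
    - assert (0 <= a * - b) by (apply Rmult_le_pos; lra); split; nra.
    - assert (0 <= - a * b) by (apply Rmult_le_pos; lra); split; nra. }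
  eapply Rle_trans; [apply Rabs_triang|].
  rewrite Rabs_mult, <- RPow_abs; rewrite <- (pow2_abs (t' - t)) in HR.
  apply Rle_trans with (K * Rabs (t' - t) * Rabs (t' - t)).
  - unfold K; simpl in *; lra.
  - apply Rmult_le_compat_r; [apply Rabs_pos|].
    apply Rle_trans with (K * (eps / K)); [|right; field; lra].
    apply Rmult_le_compat_l; lra.
Qed.

Lemma diff01_green1 t s : t <> s -> diff01 (fun r => green1 r s) t (green2 t s).
Proof.
  intros Hts; apply is_derive_diff01; unfold green1, green2.
  apply (is_derive_plus (fun r => (v1 + v2 * r) * gker s)).
  - auto_derive; [exact I|ring].
  - destruct (Rlt_dec s t) as [Hlt|Hge].
    + apply (is_derive_ext_loc (fun r => r - s)).
      * assert (Hp : 0 < t - s) by lra.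
        exists (mkposreal _ Hp); intros r Hr; change (Rabs (r - t) < t - s) in Hr.
        apply Rabs_lt_between in Hr; rewrite Rmax_right; lra.
      * auto_derive; [exact I|ring].
    + apply (is_derive_ext_loc (fun r => 0)).
      * assert (Hp : 0 < s - t) by lra.
        exists (mkposreal _ Hp); intros r Hr; change (Rabs (r - t) < s - t) in Hr.
        apply Rabs_lt_between in Hr; rewrite Rmax_left; lra.
      * auto_derive; [exact I|ring].
Qed.

Variable phi : R -> R.
Hypothesis Hphi : forall s, continuous phi s.

(** Expanding [(t - s)^2] in powers of [s] turns the integrals over [[0, t]] into combinations of
    moments, so no differentiation under the integral sign is needed. *)
Definition moment (j : nat) (t : R) : R := RInt (fun s => s ^ j * phi s) 0 t.

Lemma continuous_pow_phi j s : continuous (fun s => s ^ j * phi s) s.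
Proof.
  apply (continuous_mult (fun s => s ^ j) phi); [|apply Hphi].
  apply (ex_derive_continuous (V := R_NormedModule)); auto_derive; exact I.
Qed.

Lemma is_RInt_moment j t : is_RInt (fun s => s ^ j * phi s) 0 t (moment j t).
Proof.
  apply (RInt_correct (fun s => s ^ j * phi s)).
  apply (ex_RInt_continuous (fun s => s ^ j * phi s)).
  intros; apply continuous_pow_phi.
Qed.

Lemma is_derive_moment j t : is_derive (moment j) t (t ^ j * phi t).
Proof.
  apply (is_derive_RInt (fun s => s ^ j * phi s) (moment j) 0 t).
  - apply filter_forall; intros x; apply is_RInt_moment.
  - apply continuous_pow_phi.
Qed.

Definition shoot : R := RInt (fun s => gker s * phi s) 0 1.

Lemma is_RInt_shoot : is_RInt (fun s => gker s * phi s) 0 1 shoot.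
Proof.
  apply (RInt_correct (fun s => gker s * phi s)).
  apply (ex_RInt_continuous (fun s => gker s * phi s)); intros s _.
  apply (continuous_mult gker phi); [|apply Hphi].
  apply (ex_derive_continuous (V := R_NormedModule)); unfold gker.
  auto_derive; exact I.
Qed.

(** The last parenthesis is the integral of [(t - s)^2 / 2 * phi s] over [[0, t]]. In [sol1] the
    zero term stays to fit the three-term shape of [is_RInt_lin3]. *)
Definition sol0 (t : R) : R := (v0 + v1 * t + v2 * (t ^ 2 / 2)) * shoot
  + (t ^ 2 / 2 * moment 0 t + - t * moment 1 t + / 2 * moment 2 t).
Definition sol1 (t : R) : R :=
  (v1 + v2 * t) * shoot + (t * moment 0 t + - 1 * moment 1 t + 0 * moment 2 t).
Definition sol2 (t : R) : R := v2 * shoot + moment 0 t.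

Lemma is_derive_sol0 t : is_derive sol0 t (sol1 t).
Proof.
  unfold sol0, sol1; auto_derive.
  - repeat split; eexists; apply is_derive_moment.
  - rewrite !(is_derive_unique _ _ _ (is_derive_moment _ t)); simpl; field.
Qed.

Lemma is_derive_sol1 t : is_derive sol1 t (sol2 t).
Proof.
  unfold sol1, sol2; auto_derive.
  - repeat split; eexists; apply is_derive_moment.
  - rewrite !(is_derive_unique _ _ _ (is_derive_moment _ t)); simpl; field.
Qed.

Lemma is_derive_sol2 t : is_derive sol2 t (phi t).
Proof.
  unfold sol2; auto_derive.
  - repeat split; eexists; apply is_derive_moment.
  - rewrite !(is_derive_unique _ _ _ (is_derive_moment _ t)); simpl; field.
Qed.

Lemma is_RInt_green0 t : 0 <= t <= 1 ->
  is_RInt (fun s => green0 t s * phi s) 0 1 (sol0 t).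
Proof.
  intros Ht.
  apply (is_RInt_ext (fun s => (v0 + v1 * t + v2 * (t ^ 2 / 2)) * (gker s * phi s)
    + Rmax 0 (t - s) ^ 2 / 2 * phi s)).
  { intros s _; unfold green0; simpl; ring. }
  apply (is_RInt_plus (fun s => _ * (gker s * phi s))).
  - apply (is_RInt_scal (fun s => gker s * phi s)), is_RInt_shoot.
  - apply (is_RInt_truncated _ _ t _ Ht (is_RInt_lin3 _ _ _ _ _ (t ^ 2 / 2) (- t) (/ 2)
      _ _ _ (is_RInt_moment 0 t) (is_RInt_moment 1 t) (is_RInt_moment 2 t)));
      intros s Hs; simpl.
    + rewrite Rmax_right by lra; field.
    + rewrite Rmax_left by lra; field.
Qed.

Lemma is_RInt_green1 t : 0 <= t <= 1 ->
  is_RInt (fun s => green1 t s * phi s) 0 1 (sol1 t).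
Proof.
  intros Ht.
  apply (is_RInt_ext (fun s => (v1 + v2 * t) * (gker s * phi s)
    + Rmax 0 (t - s) * phi s)).
  { intros s _; unfold green1; simpl; ring. }
  apply (is_RInt_plus (fun s => _ * (gker s * phi s))).
  - apply (is_RInt_scal (fun s => gker s * phi s)), is_RInt_shoot.
  - apply (is_RInt_truncated _ _ t _ Ht (is_RInt_lin3 _ _ _ _ _ t (- 1) 0
      _ _ _ (is_RInt_moment 0 t) (is_RInt_moment 1 t) (is_RInt_moment 2 t)));
      intros s Hs; simpl.
    + rewrite Rmax_right by lra; ring.
    + rewrite Rmax_left by lra; ring.
Qed.

Lemma is_RInt_green2 t : 0 <= t <= 1 ->
  is_RInt (fun s => green2 t s * phi s) 0 1 (sol2 t).
Proof.
  intros Ht.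
  apply (is_RInt_ext (fun s => v2 * (gker s * phi s)
    + (if Rlt_dec s t then 1 else 0) * phi s)).
  { intros s _; unfold green2; simpl; ring. }
  apply (is_RInt_plus (fun s => _ * (gker s * phi s))).
  - apply (is_RInt_scal (fun s => gker s * phi s)), is_RInt_shoot.
  - apply (is_RInt_truncated _ _ t _ Ht (is_RInt_moment 0 t)); intros s Hs; simpl;
      destruct (Rlt_dec s t); lra.
Qed.

(** [gker] is a polynomial in [s], so [shoot] is a combination of moments at [1]; the claim then
    becomes a linear identity in these moments. *)
Lemma sol_end : a3 * sol0 1 + b3 * sol1 1 + c3 * sol2 1 = 0.
Proof.
  assert (E : shoot = - (a3 / 2 + b3 + c3) / D * moment 0 1
      + (a3 + b3) / D * moment 1 1 + - (a3 / 2) / D * moment 2 1).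
  { apply is_RInt_unique.
    apply (is_RInt_ext (fun s => - (a3 / 2 + b3 + c3) / D * (s ^ 0 * phi s)
      + (a3 + b3) / D * (s ^ 1 * phi s) + - (a3 / 2) / D * (s ^ 2 * phi s))).
    - intros s _; unfold gker; simpl; field; assumption.
    - apply is_RInt_lin3; apply is_RInt_moment. }
  unfold sol0, sol1, sol2.
  replace (a3 * ((v0 + v1 * 1 + v2 * (1 ^ 2 / 2)) * shoot + (1 ^ 2 / 2 * moment 0 1
      + - (1) * moment 1 1 + / 2 * moment 2 1))
    + b3 * ((v1 + v2 * 1) * shoot + (1 * moment 0 1 + - 1 * moment 1 1 + 0 * moment 2 1))
    + c3 * (v2 * shoot + moment 0 1))
    with (D * shoot + ((a3 / 2 + b3 + c3) * moment 0 1 - (a3 + b3) * moment 1 1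
      + a3 / 2 * moment 2 1)) by (unfold D; field).
  rewrite E; field; assumption.
Qed.

Lemma moment_0 j : moment j 0 = 0.
Proof. apply (RInt_point 0 (fun s => s ^ j * phi s)). Qed.

Lemma sol_is_sol3 a1 b1 c1 a2 b2 c2 :
  a1 * v0 + b1 * v1 + c1 * v2 = 0 -> a2 * v0 + b2 * v1 + c2 * v2 = 0 ->
  is_sol3 (fun t _ _ _ => phi t) a1 b1 c1 a2 b2 c2 a3 b3 c3 sol0 sol1 sol2.
Proof.
  intros H1 H2.
  assert (H0 : forall a b c, a * v0 + b * v1 + c * v2 = 0 ->
      a * sol0 0 + b * sol1 0 + c * sol2 0 = 0).
  { intros a b c H; unfold sol0, sol1, sol2; rewrite !moment_0.
    transitivity ((a * v0 + b * v1 + c * v2) * shoot); [field|rewrite H; ring]. }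
  split; [|split; [|split; [|split]]].
  - intros t _; split; apply derive01_diff01, is_derive_diff01;
      [apply is_derive_sol0|apply is_derive_sol1].
  - intros t _; apply is_derive_sol2.
  - now apply H0.
  - now apply H0.
  - apply sol_end.
Qed.

End ExplicitGreen.

(** * Comparison of the Green functions and a priori bounds *)

Definition clamp (a b x : R) : R := Rmax a (Rmin b x).

Lemma clamp_in a b x : a <= b -> a <= clamp a b x <= b.
Proof.
  unfold clamp, Rmax, Rmin; intros Hab.
  destruct (Rle_dec b x); destruct (Rle_dec a _); lra.
Qed.

Lemma clamp_id a b x : a <= x <= b -> clamp a b x = x.
Proof.
  unfold clamp, Rmax, Rmin; intros Hx.
  destruct (Rle_dec b x); destruct (Rle_dec a _); lra.
Qed.

Lemma clamp_lipschitz a b x y : Rabs (clamp a b x - clamp a b y) <= Rabs (x - y).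
Proof.
  unfold clamp, Rmax, Rmin.
  destruct (Rle_dec b x), (Rle_dec b y); repeat destruct (Rle_dec a _);
    unfold Rabs; repeat destruct (Rcase_abs _); lra.
Qed.

(** Extension by the endpoint values lets results about functions continuous on the whole line
    apply. *)
Lemma cont01_clamp phi s : cont01 phi -> continuous (fun s => phi (clamp 0 1 s)) s.
Proof.
  intros Hphi; pose proof (clamp_in 0 1 s Rle_0_1) as Hs.
  apply filterlim_locally; intros eps.
  destruct (proj1 (filterlim_locally _ _) (Hphi _ Hs) eps) as [d Hd].
  exists d; intros r Hr; apply Hd; [|now apply clamp_in, Rle_0_1].
  eapply Rle_lt_trans; [apply clamp_lipschitz|exact Hr].
Qed.

(* If the determinant [p . (r1 x r2)] vanished, one of the cross products or the
   vectors orthogonal to a single row would be a nonzero kernel vector. *)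
Lemma triple_product_neq0 a1 b1 c1 a2 b2 c2 a3 b3 c3 :
  (forall x y z, a1 * x + b1 * y + c1 * z = 0 -> a2 * x + b2 * y + c2 * z = 0 ->
     a3 * x + b3 * y + c3 * z = 0 -> x = 0 /\ y = 0 /\ z = 0) ->
  a3 * (b1 * c2 - c1 * b2) + b3 * (c1 * a2 - a1 * c2) + c3 * (a1 * b2 - b1 * a2) <> 0.
Proof.
  intros H HD.
  destruct (H (b1 * c2 - c1 * b2) (c1 * a2 - a1 * c2) (a1 * b2 - b1 * a2))
    as [X1 [Y1 Z1]]; [ring|ring|assumption|].
  destruct (H (b1 * c3 - c1 * b3) (c1 * a3 - a1 * c3) (a1 * b3 - b1 * a3))
    as [X2 [Y2 Z2]]; [ring| |ring|].
  { rewrite <- (Ropp_involutive 0), Ropp_0, <- HD; ring. }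
  destruct (H (b2 * c3 - c2 * b3) (c2 * a3 - a2 * c3) (a2 * b3 - b2 * a3))
    as [X3 [Y3 Z3]]; [|ring|ring|].
  { rewrite <- HD; ring. }
  destruct (H (- b1) a1 0) as [E1 [E2 _]]; [ring|lra|lra|].
  destruct (H 0 (- c1) b1) as [_ [E3 _]]; [ring|lra|lra|].
  destruct (H (- b2) a2 0) as [E4 [E5 _]]; [lra|ring|lra|].
  destruct (H 0 (- c2) b2) as [_ [E6 _]]; [lra|ring|lra|].
  destruct (H (- b3) a3 0) as [E7 [E8 _]]; [lra|lra|ring|].
  destruct (H 0 (- c3) b3) as [_ [E9 _]]; [lra|lra|ring|].
  destruct (H 1 0 0) as [E _]; lra.
Qed.

Lemma green_unique a1 b1 c1 a2 b2 c2 a3 b3 c3 G phi u u1 u2 w w1 w2 :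
  is_green a1 b1 c1 a2 b2 c2 a3 b3 c3 G -> cont01 phi ->
  is_sol3 (fun t _ _ _ => phi t) a1 b1 c1 a2 b2 c2 a3 b3 c3 u u1 u2 ->
  is_sol3 (fun t _ _ _ => phi t) a1 b1 c1 a2 b2 c2 a3 b3 c3 w w1 w2 ->
  forall t, 0 <= t <= 1 -> u t = w t /\ u1 t = w1 t /\ u2 t = w2 t.
Proof.
  intros HG Hphi Hu Hw; destruct (HG phi Hphi) as [_ HG'].
  assert (E0 : forall t, 0 <= t <= 1 -> u t = w t).
  { intros t Ht.
    rewrite <- (is_RInt_unique _ _ _ _ (HG' _ _ _ Hu t Ht)).
    apply is_RInt_unique, (HG' _ _ _ Hw t Ht). }
  destruct Hu as [Hu _], Hw as [Hw _].
  assert (E1 : forall t, 0 <= t <= 1 -> u1 t = w1 t).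
  { intros t Ht; apply (diff01_unique u w t _ _ Ht E0); apply derive01_diff01;
      [apply Hu|apply Hw]; assumption. }
  intros t Ht; repeat split; auto.
  apply (diff01_unique u1 w1 t _ _ Ht E1); apply derive01_diff01;
    [apply Hu|apply Hw]; assumption.
Qed.

(** [(v0, v1, v2)] is the cross product of the rows of [B1] and [B2], and the expression is its
    product with the row of [B3] in terms of initial data at [0]. A kernel vector [(x, y, z)] gives
    the homogeneous solution [x + y t + z t^2 / 2], which vanishes by uniqueness. *)
Lemma green_nondegenerate a1 b1 c1 a2 b2 c2 a3 b3 c3 G :
  is_green a1 b1 c1 a2 b2 c2 a3 b3 c3 G ->
  let v0 := b1 * c2 - c1 * b2 in
  let v1 := c1 * a2 - a1 * c2 in
  let v2 := a1 * b2 - b1 * a2 in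
  a3 * (v0 + v1 + v2 / 2) + b3 * (v1 + v2) + c3 * v2 <> 0.
Proof.
  intros HG v0 v1 v2.
  replace (a3 * (v0 + v1 + v2 / 2) + b3 * (v1 + v2) + c3 * v2)
    with (a3 * v0 + (a3 + b3) * v1 + (a3 / 2 + b3 + c3) * v2) by field.
  apply triple_product_neq0; intros x y z H1 H2 H3.
  assert (Hc : cont01 (fun _ => 0)) by
    (apply continuous_cont01; intros; apply continuous_const).
  destruct (green_unique _ _ _ _ _ _ _ _ _ G (fun _ => 0)
    (fun t => x + y * t + z * (t ^ 2 / 2)) (fun t => y + z * t) (fun _ => z)
    (fun _ => 0) (fun _ => 0) (fun _ => 0) HG Hc) with (t := 0) as [E1 [E2 E3]].
  - split; [|split; [|split; [|split]]].
    + intros t _; split; apply derive01_diff01, is_derive_diff01; auto_derive;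
        solve [exact I|field].
    + intros t _; auto_derive; [exact I|reflexivity].
    + transitivity (a1 * x + b1 * y + c1 * z); [field|assumption].
    + transitivity (a2 * x + b2 * y + c2 * z); [field|assumption].
    + transitivity (a3 * x + (a3 + b3) * y + (a3 / 2 + b3 + c3) * z); [field|assumption].
  - split; [|split; [|split; [|split]]]; try ring.
    + intros t _; split; apply derive01_diff01, is_derive_diff01; auto_derive;
        solve [exact I|ring].
    + intros t _; auto_derive; [exact I|reflexivity].
  - lra.
  - simpl in E1; lra.
Qed.

Section Apriori.

Variables a1 b1 c1 a2 b2 c2 a3 b3 c3 : R.
Variables (G G1 G2 : R -> R -> R) (v0 v1 v2 : R).
Hypothesis HG : is_green a1 b1 c1 a2 b2 c2 a3 b3 c3 G.
Hypothesis HG1 : forall t s, 0 <= t <= 1 -> 0 <= s <= 1 ->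
  derive01 (fun r => G r s) t (G1 t s).
Hypothesis HG2 : forall t s, 0 <= t <= 1 -> 0 <= s <= 1 -> t <> s ->
  derive01 (fun r => G1 r s) t (G2 t s).
Hypothesis HB1 : a1 * v0 + b1 * v1 + c1 * v2 = 0.
Hypothesis HB2 : a2 * v0 + b2 * v1 + c2 * v2 = 0.
Hypothesis HD : a3 * (v0 + v1 + v2 / 2) + b3 * (v1 + v2) + c3 * v2 <> 0.

Let g := green0 v0 v1 v2 a3 b3 c3.
Let g1 := green1 v0 v1 v2 a3 b3 c3.
Let g2 := green2 v0 v1 v2 a3 b3 c3.

(** Both kernels represent the same solution [sol0], for the extension [psi] of [phi]. *)
Lemma green_diff_orthogonal t phi : 0 <= t <= 1 -> cont01 phi ->
  is_RInt (fun s => (G t s - g t s) * phi s) 0 1 0.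
Proof.
  intros Ht Hphi.
  set (psi := fun s => phi (clamp 0 1 s)).
  assert (Hpsi : forall s, continuous psi s) by (intros; now apply cont01_clamp).
  destruct (HG psi (continuous_cont01 psi Hpsi)) as [_ HG'].
  specialize (HG' _ _ _ (sol_is_sol3 v0 v1 v2 a3 b3 c3 HD psi Hpsi _ _ _ _ _ _ HB1 HB2)
    t Ht).
  pose proof (is_RInt_green0 v0 v1 v2 a3 b3 c3 psi Hpsi t Ht) as Hg.
  pose proof (is_RInt_minus _ _ _ _ _ _ HG' Hg) as Hm; rewrite minus_eq_zero in Hm.
  revert Hm; apply is_RInt_ext; intros s.
  rewrite Rmin_left, Rmax_right by lra; intros Hs.
  unfold psi; rewrite clamp_id by lra.
  change (G t s * phi s - g t s * phi s = (G t s - g t s) * phi s); ring.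
Qed.

(* By the Baire argument, [G] and [g] agree at all rational times on a dense set of
   [s]; continuity in the first variable extends this to all times. *)
Lemma green_agree_dense a b : 0 <= a -> a < b -> b <= 1 ->
  exists s, a < s < b /\ forall t, 0 <= t <= 1 -> G t s = g t s.
Proof.
  intros Ha Hab Hb.
  (* [r] runs through the rational times in the unit interval. Cantor pairing packs a time [r k j]
     and a tolerance [mesh m] into one index, so countably many conditions express agreement at all
     these times. *)
  set (r := fun i j : nat => clamp 0 1 (INR i * mesh j)).
  set (Q := fun (n : nat) s => let (i, m) := Cantor.of_nat n in
    let (k, j) := Cantor.of_nat i in
    Rabs (G (r k j) s - g (r k j) s) <= mesh m).
  assert (HQ : forall n x y, 0 <= x -> x < y -> y <= 1 ->
     exists x' y', x < x' /\ x' < y' /\ y' < y /\ forall s, x' <= s <= y' -> Q n s).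
  { intros n x y Hx Hxy Hy; unfold Q.
    destruct (Cantor.of_nat n) as [i m]; destruct (Cantor.of_nat i) as [k j].
    apply (small_subinterval (fun s => G (r k j) s - g (r k j) s));
      try assumption; [|apply mesh_pos].
    intros phi Hphi; apply green_diff_orthogonal; [|assumption].
    apply clamp_in, Rle_0_1. }
  destruct (baire01 Q HQ a b Ha Hab Hb) as [s [Hs HQs]].
  exists s; split; [assumption|].
  assert (Hr : forall k j, G (r k j) s = g (r k j) s).
  { intros k j; apply Rminus_diag_uniq, Rabs_eq_0.
    apply Rle_antisym; [|apply Rabs_pos].
    apply le_epsilon; intros eps Heps; rewrite Rplus_0_l.
    destruct (mesh_small eventually eps (fun P H => H) Heps) as [m Hm].
    specialize (HQs (Cantor.to_nat (Cantor.to_nat (k, j), m))); unfold Q in HQs.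
    rewrite !Cantor.cancel_of_to in HQs.
    specialize (Hm m (le_n m)); lra. }
  intros t Ht; apply Rminus_diag_uniq, Rabs_eq_0.
  apply Rle_antisym; [|apply Rabs_pos].
  apply le_epsilon; intros eps Heps; rewrite Rplus_0_l.
  assert (Hs1 : 0 <= s <= 1) by lra.
  pose proof (proj1 (derive01_diff01 _ _ _) (HG1 t s Ht Hs1)) as DG.
  pose proof (diff01_green0 v0 v1 v2 a3 b3 c3 t s) as Dg; fold g g1 in Dg.
  destruct (DG 1 Rlt_0_1) as [d1 [Hd1 H1]]; destruct (Dg 1 Rlt_0_1) as [d2 [Hd2 H2]].
  (* At a mesh point [t'] the kernels agree. Differentiability of each at [t], used with error [1],
     then bounds their difference at [t] by [K] times the distance from [t'] to [t]. *)
  set (K := Rabs (G1 t s - g1 t s) + 2).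
  assert (HK : 0 < K) by (unfold K; pose proof (Rabs_pos (G1 t s - g1 t s)); lra).
  set (d := Rmin (Rmin d1 d2) (eps / K)).
  assert (Hd : 0 < d).
  { repeat apply Rmin_glb_lt; try assumption; now apply Rdiv_lt_0_compat. }
  assert (Hdd : d <= d1 /\ d <= d2 /\ d <= eps / K).
  { unfold d; pose proof (Rmin_l (Rmin d1 d2) (eps / K));
    pose proof (Rmin_r (Rmin d1 d2) (eps / K));
    pose proof (Rmin_l d1 d2); pose proof (Rmin_r d1 d2); lra. }
  destruct (mesh_small eventually d (fun P H => H) Hd) as [n Hn].
  specialize (Hn n (le_n n)).
  destruct (node_spec n t) as [N1 N2]; [lra|].
  assert (N0 : 0 <= INR (node n t) * mesh n)
    by (apply Rmult_le_pos; [apply pos_INR|left; apply mesh_pos]).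
  specialize (Hr (node n t) n); unfold r in Hr; rewrite clamp_id in Hr by lra.
  set (t' := INR (node n t) * mesh n) in *.
  assert (Htt : Rabs (t' - t) < d) by (apply Rabs_lt_between; lra).
  specialize (H1 t' ltac:(lra) ltac:(lra)); specialize (H2 t' ltac:(lra) ltac:(lra)).
  cbv beta in H1, H2.
  replace (G t s - g t s)
    with (- (G t' s - G t s - (t' - t) * G1 t s)
      + ((g t' s - g t s - (t' - t) * g1 t s) + - (t' - t) * (G1 t s - g1 t s)))
    by (rewrite Hr; ring).
  eapply Rle_trans; [apply Rabs_triang|].
  eapply Rle_trans; [apply Rplus_le_compat_l, Rabs_triang|].
  rewrite Rabs_Ropp, Rabs_mult, Rabs_Ropp.
  apply Rle_trans with (Rabs (t' - t) * K); [unfold K; lra|].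
  apply Rle_trans with (eps / K * K); [|right; field; lra].
  apply Rmult_le_compat_r; lra.
Qed.

Lemma green_derivatives_agree_dense t a b :
  0 <= t <= 1 -> 0 <= a -> a < b -> b <= 1 ->
  exists s, a < s < b /\ G t s = g t s /\ G1 t s = g1 t s /\ G2 t s = g2 t s.
Proof.
  intros Ht Ha Hab Hb.
  (* Shrinking to one side of [t] keeps [s] off the diagonal, where the second derivative is not
     given. *)
  assert (Hc : exists a', a <= a' < b /\ (t <= a' \/ b <= t)).
  { destruct (Rlt_le_dec t a); [exists a; lra|].
    destruct (Rlt_le_dec t b); [exists t; lra|exists a; lra]. }
  destruct Hc as [a' [Ha' Ht']].
  destruct (green_agree_dense a' b) as [s [Hs E0]]; try lra.
  assert (Hs1 : 0 <= s <= 1) by lra.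
  assert (E1 : forall r, 0 <= r <= 1 -> G1 r s = g1 r s).
  { intros r Hr; apply (diff01_unique (fun r => G r s) (fun r => g r s) r _ _ Hr E0).
    - now apply derive01_diff01, HG1.
    - apply diff01_green0. }
  exists s; repeat split; auto; try lra.
  assert (Hts : t <> s) by lra.
  apply (diff01_unique (fun r => G1 r s) (fun r => g1 r s) t _ _ Ht E1).
  - now apply derive01_diff01, HG2.
  - now apply diff01_green1.
Qed.

Variables (phi : R -> R) (sG sG1 M0 M1 M2 M : R).
Hypothesis Hphi : cont01 phi.
Hypothesis HsG : sign_of G sG.
Hypothesis HsG1 : sign_of G1 sG1.
Hypothesis HM0 : is_max_int G M0.
Hypothesis HM1 : is_max_int G1 M1.
Hypothesis HM2 : is_max_int G2 M2.
Hypothesis Hrange : forall t, 0 <= t <= 1 -> 0 <= sG * phi t <= M.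

Let psi s := phi (clamp 0 1 s).

(** Where [H] and [h] agree, the integrand is at most [M] times the absolute value of [H t s]; a
    dense set of such points suffices to compare the integrals. *)
Lemma green_abs_bound (H h : R -> R -> R) m t e :
  is_max_int H m -> 0 <= t <= 1 -> is_RInt (fun s => h t s * psi s) 0 1 e ->
  (forall a b, 0 <= a -> a < b -> b <= 1 -> exists s, a < s < b /\ H t s = h t s) ->
  Rabs e <= m * M.
Proof.
  intros [Hex [_ Hmax]] Ht He Hdense.
  specialize (Hex t Ht); specialize (Hmax t Ht).
  assert (HI : is_RInt (fun s => M * Rabs (H t s)) 0 1
      (M * RInt (fun s => Rabs (H t s)) 0 1)).
  { apply (is_RInt_scal (fun s => Rabs (H t s))).
    now apply (RInt_correct (fun s => Rabs (H t s))). }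
  assert (Hb : forall s, Rabs (psi s) <= M).
  { intros s; unfold psi.
    specialize (Hrange _ (clamp_in 0 1 s Rle_0_1)).
    destruct HsG as [[Hs _]|[Hs _]]; rewrite Hs in *; apply Rabs_le_between; lra. }
  assert (HM : 0 <= M) by (eapply Rle_trans; [apply Rabs_pos|apply (Hb 0)]).
  assert (Hle : M * RInt (fun s => Rabs (H t s)) 0 1 <= m * M).
  { rewrite (Rmult_comm m); now apply Rmult_le_compat_l. }
  assert (Hpt : forall s, H t s = h t s -> Rabs (h t s * psi s) <= M * Rabs (H t s)).
  { intros s ->; rewrite Rabs_mult, Rmult_comm.
    apply Rmult_le_compat_r; [apply Rabs_pos|apply Hb]. }
  apply Rabs_le_between; split.
  - assert (- e <= M * RInt (fun s => Rabs (H t s)) 0 1); [|lra].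
    apply (is_RInt_le_dense (fun s => - (h t s * psi s)) _ _ _
      (is_RInt_opp _ _ _ _ He) HI).
    intros a b Ha Hab Hb'; destruct (Hdense a b Ha Hab Hb') as [s [Hs E]].
    exists s; split; [assumption|]; specialize (Hpt s E).
    apply Rabs_le_between in Hpt; lra.
  - apply Rle_trans with (M * RInt (fun s => Rabs (H t s)) 0 1); [|assumption].
    apply (is_RInt_le_dense _ _ _ _ He HI).
    intros a b Ha Hab Hb'; destruct (Hdense a b Ha Hab Hb') as [s [Hs E]].
    exists s; split; [assumption|]; specialize (Hpt s E).
    apply Rabs_le_between in Hpt; lra.
Qed.

(** By uniqueness [u], [u1], [u2] are the explicit solution and its derivatives, hence integrals
    against the explicit kernels. Signs and norms of [G], [G1], [G2] are then transferred on dense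
    sets of [s]. *)
Lemma apriori_bounds u u1 u2 :
  is_sol3 (fun t _ _ _ => phi t) a1 b1 c1 a2 b2 c2 a3 b3 c3 u u1 u2 ->
  forall t, 0 <= t <= 1 ->
    0 <= u t <= M0 * M /\ 0 <= sG * sG1 * u1 t <= M1 * M /\ Rabs (u2 t) <= M2 * M.
Proof.
  intros Hu t Ht.
  assert (Hpsi : forall s, continuous psi s) by (intros; now apply cont01_clamp).
  set (e0 := sol0 v0 v1 v2 a3 b3 c3 psi); set (e1 := sol1 v0 v1 v2 a3 b3 c3 psi).
  set (e2 := sol2 v0 v1 v2 a3 b3 c3 psi).
  assert (Hu' : is_sol3 (fun t _ _ _ => psi t) a1 b1 c1 a2 b2 c2 a3 b3 c3 u u1 u2).
  { destruct Hu as [U1 [U2 U3]]; split; [assumption|split; [|assumption]].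
    intros r Hr; unfold psi; rewrite clamp_id by lra; now apply U2. }
  destruct (green_unique _ _ _ _ _ _ _ _ _ G psi u u1 u2 e0 e1 e2 HG
    (continuous_cont01 psi Hpsi) Hu'
    (sol_is_sol3 v0 v1 v2 a3 b3 c3 HD psi Hpsi _ _ _ _ _ _ HB1 HB2) t Ht)
    as [-> [-> ->]].
  pose proof (is_RInt_green0 v0 v1 v2 a3 b3 c3 psi Hpsi t Ht) as I0.
  pose proof (is_RInt_green1 v0 v1 v2 a3 b3 c3 psi Hpsi t Ht) as I1.
  pose proof (is_RInt_green2 v0 v1 v2 a3 b3 c3 psi Hpsi t Ht) as I2.
  fold g e0 in I0; fold g1 e1 in I1; fold g2 e2 in I2.
  pose proof (green_derivatives_agree_dense t) as Hag.
  assert (A0 : Rabs (e0 t) <= M0 * M).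
  { apply (green_abs_bound G g M0 t _ HM0 Ht I0); intros a b Ha Hab Hb.
    destruct (Hag a b Ht Ha Hab Hb) as [s [Hs [E _]]]; now exists s. }
  assert (A1 : Rabs (e1 t) <= M1 * M).
  { apply (green_abs_bound G1 g1 M1 t _ HM1 Ht I1); intros a b Ha Hab Hb.
    destruct (Hag a b Ht Ha Hab Hb) as [s [Hs [_ [E _]]]]; now exists s. }
  assert (A2 : Rabs (e2 t) <= M2 * M).
  { apply (green_abs_bound G2 g2 M2 t _ HM2 Ht I2); intros a b Ha Hab Hb.
    destruct (Hag a b Ht Ha Hab Hb) as [s [Hs [_ [_ E]]]]; now exists s. }
  assert (HsG2 : sG * sG = 1) by (destruct HsG as [[-> _]|[-> _]]; ring).
  assert (Hpos : forall s, 0 <= sG * psi s)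
    by (intros s; apply Hrange, clamp_in, Rle_0_1).
  assert (P0 : 0 <= e0 t).
  { apply (is_RInt_ge0_dense (fun s => g t s * psi s) _ I0); intros a b Ha Hab Hb.
    destruct (Hag a b Ht Ha Hab Hb) as [s [Hs [E _]]]; exists s; split; [assumption|].
    replace (g t s * psi s) with ((sG * G t s) * (sG * psi s))
      by (rewrite E; transitivity (sG * sG * (g t s * psi s)); [ring|rewrite HsG2; ring]).
    apply Rmult_le_pos; [|apply Hpos].
    destruct HsG as [[-> HH]|[-> HH]]; specialize (HH t s Ht ltac:(lra)); lra. }
  assert (P1 : 0 <= sG * sG1 * e1 t).
  { apply (is_RInt_ge0_dense (fun s => sG * sG1 * (g1 t s * psi s))).
    - now apply (is_RInt_scal (fun s => g1 t s * psi s)).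
    - intros a b Ha Hab Hb.
      destruct (Hag a b Ht Ha Hab Hb) as [s [Hs [_ [E _]]]]; exists s.
      split; [assumption|].
      replace (sG * sG1 * (g1 t s * psi s)) with ((sG1 * G1 t s) * (sG * psi s))
        by (rewrite E; ring).
      apply Rmult_le_pos; [|apply Hpos].
      destruct HsG1 as [[-> HH]|[-> HH]]; specialize (HH t s Ht ltac:(lra)); lra. }
  assert (Q1 : Rabs (sG * sG1 * e1 t) = Rabs (e1 t)).
  { rewrite (Rabs_mult (sG * sG1)).
    destruct HsG as [[-> _]|[-> _]], HsG1 as [[-> _]|[-> _]];
      [rewrite (Rabs_pos_eq (1 * 1))|rewrite (Rabs_left1 (1 * -1))
      |rewrite (Rabs_left1 (-1 * 1))|rewrite (Rabs_pos_eq (-1 * -1))]; lra. }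
  rewrite (Rabs_pos_eq _ P0) in A0; rewrite <- Q1, (Rabs_pos_eq _ P1) in A1.
  repeat split; assumption.
Qed.

End Apriori.

(** * Monotonicity and existence for the nonlinear problem *)

Lemma diff01_cont01 u u1 : (forall t, 0 <= t <= 1 -> diff01 u t (u1 t)) -> cont01 u.
Proof.
  intros Hu.
  intros s Hs; apply filterlim_locally; intros eps.
  destruct (Hu s Hs 1 Rlt_0_1) as [d [Hd Hud]].
  set (K := Rabs (u1 s) + 1).
  assert (HK : 0 < K) by (unfold K; pose proof (Rabs_pos (u1 s)); lra).
  assert (Hp : 0 < Rmin d (eps / K)).
  { apply Rmin_glb_lt; [assumption|]; apply Rdiv_lt_0_compat; [apply cond_pos|lra]. }
  exists (mkposreal _ Hp); intros y Hy Hy1; change (Rabs (y - s) < Rmin d (eps / K)) in Hy.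
  pose proof (Rmin_l d (eps / K)); pose proof (Rmin_r d (eps / K)).
  specialize (Hud y Hy1 ltac:(lra)).
  change (Rabs (u y - u s) < eps).
  replace (u y - u s) with ((u y - u s - (y - s) * u1 s) + (y - s) * u1 s) by ring.
  eapply Rle_lt_trans; [apply Rabs_triang|].
  rewrite (Rabs_mult (y - s)).
  apply Rle_lt_trans with (Rabs (y - s) * K); [unfold K; lra|].
  apply Rlt_le_trans with (eps / K * K); [|right; field; lra].
  apply Rmult_lt_compat_r; lra.
Qed.

Lemma derive01_monotone u u1 : (forall t, 0 <= t <= 1 -> derive01 u t (u1 t)) ->
  (forall t, 0 <= t <= 1 -> 0 <= u1 t) ->
  forall t t', 0 <= t -> t <= t' -> t' <= 1 -> u t <= u t'.
Proof.
  intros Hu H1 t t' Ht Htt Ht'.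
  (* The clamped extension is continuous at [0] and [1] as well and coincides with [u] near interior
     points. *)
  destruct (MVT_gen (fun s => u (clamp 0 1 s)) t t' u1) as [x [Hx E]].
  - rewrite Rmin_left, Rmax_right by lra; intros x Hx.
    apply (is_derive_ext_loc u).
    + assert (Hp : 0 < Rmin x (1 - x)) by (apply Rmin_glb_lt; lra).
      exists (mkposreal _ Hp); intros y Hy; change (Rabs (y - x) < Rmin x (1 - x)) in Hy.
      pose proof (Rmin_l x (1 - x)); pose proof (Rmin_r x (1 - x)).
      apply Rabs_lt_between in Hy; rewrite clamp_id; [reflexivity|lra].
    + apply diff01_is_derive; [lra|]; apply derive01_diff01, Hu; lra.
  - intros x _; apply continuity_pt_filterlim, cont01_clamp.
    apply (diff01_cont01 u u1); intros s Hs; now apply derive01_diff01, Hu.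
  - rewrite Rmin_left, Rmax_right in Hx by lra.
    rewrite !clamp_id in E by lra.
    specialize (H1 x ltac:(lra)); nra.
Qed.

Theorem theorem2
  (a1 b1 c1 a2 b2 c2 a3 b3 c3 : R)
  (G G1 G2 : R -> R -> R) (sG sG1 M0 M1 M2 M : R)
  (f : R -> R -> R -> R -> R)
  (Hrank : bc_rank3 a1 b1 c1 a2 b2 c2 a3 b3 c3)
  (Hgreen : is_green a1 b1 c1 a2 b2 c2 a3 b3 c3 G)
  (HG1 : forall t s, 0 <= t <= 1 -> 0 <= s <= 1 ->
           derive01 (fun r => G r s) t (G1 t s))
  (HG2 : forall t s, 0 <= t <= 1 -> 0 <= s <= 1 -> t <> s ->
           derive01 (fun r => G1 r s) t (G2 t s))
  (HsG : sign_of G sG) (HsG1 : sign_of G1 sG1)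
  (HM0 : is_max_int G M0) (HM1 : is_max_int G1 M1) (HM2 : is_max_int G2 M2)
  (HMpos : 0 < M)
  (Hfc : cont_on4 (DMplus M0 M1 M2 sG sG1 M) f)
  (Hfb : forall t x y z, DMplus M0 M1 M2 sG sG1 M t x y z ->
           0 <= sG * f t x y z <= M) :
  exists u u1 u2 : R -> R,
    is_sol3 f a1 b1 c1 a2 b2 c2 a3 b3 c3 u u1 u2 /\
    (forall t, 0 <= t <= 1 ->
       0 <= u t <= M0 * M /\
       0 <= sG * sG1 * u1 t <= M1 * M /\
       Rabs (u2 t) <= M2 * M) /\
    ((forall t t', 0 <= t -> t <= t' -> t' <= 1 -> u t <= u t') \/
     (forall t t', 0 <= t -> t <= t' -> t' <= 1 -> u t' <= u t)) /\
    (sG * sG1 = 1 -> forall t t', 0 <= t -> t <= t' -> t' <= 1 -> u t <= u t') /\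
    (sG * sG1 = -1 -> forall t t', 0 <= t -> t <= t' -> t' <= 1 -> u t' <= u t).
Proof.
  assert (Hm : forall H m, is_max_int H m -> 0 <= m * M).
  { intros H m [Hex [[t0 [Ht0 <-]] _]]; apply Rmult_le_pos; [|lra].
    apply RInt_ge_0; [lra|now apply Hex|intros; apply Rabs_pos]. }
  pose proof (Hm _ _ HM0) as P0; pose proof (Hm _ _ HM1) as P1.
  pose proof (Hm _ _ HM2) as P2; clear Hm.
  assert (Hsg : sG * sG1 = 1 \/ sG * sG1 = -1).
  { destruct HsG as [[-> _]|[-> _]], HsG1 as [[-> _]|[-> _]]; lra. }
  set (sg := sG * sG1) in *.
  assert (Hsg2 : sg * sg = 1) by (destruct Hsg as [-> | ->]; ring).
  assert (Habs : forall x, Rabs (sg * x) = Rabs x).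
  { intros x; destruct Hsg as [-> | ->]; [now rewrite Rmult_1_l|].
    replace (-1 * x) with (- x) by ring; apply Rabs_Ropp. }
  (* The projection onto [DMplus]. Multiplying by [sg], which is [1] or [-1], before and after the
     clamp handles both orientations of the [y]-interval. *)
  set (cx := clamp 0 (M0 * M)); set (cy := fun y => sg * clamp 0 (M1 * M) (sg * y)).
  set (cz := clamp (- (M2 * M)) (M2 * M)).
  set (F := fun t x y z => f (clamp 0 1 t) (cx x) (cy y) (cz z)).
  assert (Hin : forall t x y z,
      DMplus M0 M1 M2 sG sG1 M (clamp 0 1 t) (cx x) (cy y) (cz z)).
  { intros t x y z; unfold DMplus; fold sg; split; [|split; [|split]].
    - apply clamp_in; lra.
    - now apply clamp_in.
    - unfold cy; rewrite <- Rmult_assoc, Hsg2, Rmult_1_l; now apply clamp_in.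
    - apply Rabs_le_between, clamp_in; lra. }
  assert (HFb : forall t x y z, 0 <= sG * F t x y z <= M)
    by (intros; apply Hfb, Hin).
  assert (HFabs : forall t x y z, Rabs (F t x y z) <= M).
  { intros t x y z; specialize (HFb t x y z).
    destruct HsG as [[E _]|[E _]]; rewrite E in HFb; apply Rabs_le_between; lra. }
  assert (HFc : cont4 F).
  { intros t x y z eps Heps.
    destruct (Hfc _ _ _ _ (Hin t x y z) eps Heps) as [d [Hd H]].
    exists d; split; [assumption|]; intros t' x' y' z' Ht Hx Hy Hz.
    apply H; [apply Hin| | | |].
    - exact (Rle_lt_trans _ _ _ (clamp_lipschitz _ _ _ _) Ht).
    - exact (Rle_lt_trans _ _ _ (clamp_lipschitz _ _ _ _) Hx).
    - unfold cy; rewrite <- Rmult_minus_distr_l, Habs.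
      eapply Rle_lt_trans; [apply clamp_lipschitz|].
      now rewrite <- Rmult_minus_distr_l, Habs.
    - exact (Rle_lt_trans _ _ _ (clamp_lipschitz _ _ _ _) Hz). }
  pose proof (green_nondegenerate _ _ _ _ _ _ _ _ _ _ Hgreen) as HD; cbv zeta in HD.
  set (v0 := b1 * c2 - c1 * b2) in HD; set (v1 := c1 * a2 - a1 * c2) in HD.
  set (v2 := a1 * b2 - b1 * a2) in HD.
  assert (HB1 : a1 * v0 + b1 * v1 + c1 * v2 = 0) by (unfold v0, v1, v2; ring).
  assert (HB2 : a2 * v0 + b2 * v1 + c2 * v2 = 0) by (unfold v0, v1, v2; ring).
  destruct (shooting_solution F M v0 v1 v2 a1 b1 c1 a2 b2 c2 a3 b3 c3
    HFc HFabs HB1 HB2 HD) as [u [u1 [u2 [Hsol Hu3]]]].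
  pose proof Hsol as [Hu12 [Hder Hbc]].
  (* Along the solution the projected problem is linear with right-hand side [phi], so the a priori
     bounds apply. *)
  set (phi := fun t => F t (u t) (u1 t) (u2 t)).
  assert (Hphi : cont01 phi).
  { intros t Ht; apply filterlim_locally; intros eps.
    destruct (HFc t (u t) (u1 t) (u2 t) eps (cond_pos eps)) as [d [Hd H]].
    assert (C : forall w w1, (forall t, 0 <= t <= 1 -> diff01 w t (w1 t)) ->
        within (fun x => 0 <= x <= 1) (locally t) (fun x => Rabs (w x - w t) < d)).
    { intros w w1 Hw.
      exact (proj1 (filterlim_locally _ _) (diff01_cont01 w w1 Hw t Ht) (mkposreal d Hd)). }
    assert (C0 : within (fun x => 0 <= x <= 1) (locally t) (fun x => Rabs (x - t) < d))
      by (exists (mkposreal d Hd); intros x Hx _; exact Hx).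
    assert (Cx := C u u1 (fun t Ht => proj1 (derive01_diff01 _ _ _) (proj1 (Hu12 t Ht)))).
    assert (Cy := C u1 u2 (fun t Ht => proj1 (derive01_diff01 _ _ _) (proj2 (Hu12 t Ht)))).
    assert (Cz := C u2 _ Hu3).
    generalize (filter_and _ _ (filter_and _ _ C0 Cx) (filter_and _ _ Cy Cz)).
    apply filter_imp; intros x [[H1 H2] [H3 H4]]; now apply H. }
  assert (Hbounds : forall t, 0 <= t <= 1 ->
      0 <= u t <= M0 * M /\ 0 <= sg * u1 t <= M1 * M /\ Rabs (u2 t) <= M2 * M).
  { apply (apriori_bounds a1 b1 c1 a2 b2 c2 a3 b3 c3 G G1 G2 v0 v1 v2 Hgreen HG1 HG2
      HB1 HB2 HD phi sG sG1 M0 M1 M2 M Hphi HsG HsG1 HM0 HM1 HM2).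
    - intros t _; apply HFb.
    - exact Hsol. }
  assert (Hinc : sg = 1 -> forall t t', 0 <= t -> t <= t' -> t' <= 1 -> u t <= u t').
  { intros E; apply (derive01_monotone u u1).
    - intros t Ht; apply (Hu12 t Ht).
    - intros t Ht; destruct (Hbounds t Ht) as [_ [H _]]; rewrite E in H; lra. }
  assert (Hdec : sg = -1 -> forall t t', 0 <= t -> t <= t' -> t' <= 1 -> u t' <= u t).
  { intros E t t' Ht Htt Ht'; apply Ropp_le_cancel; revert t t' Ht Htt Ht'.
    apply (derive01_monotone (fun t => - u t) (fun t => - u1 t)).
    - intros t Ht; apply derive01_diff01; intros eps Heps.
      destruct (proj1 (derive01_diff01 _ _ _) (proj1 (Hu12 t Ht)) eps Heps)
        as [d [Hd H]].
      exists d; split; [assumption|]; intros t' Ht' Htt'; rewrite <- Rabs_Ropp.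
      replace (- (- u t' - - u t - (t' - t) * - u1 t))
        with (u t' - u t - (t' - t) * u1 t) by ring.
      now apply H.
    - intros t Ht; destruct (Hbounds t Ht) as [_ [H _]]; rewrite E in H; lra. }
  exists u, u1, u2; split; [|split; [exact Hbounds|split; [|split; assumption]]].
  - split; [exact Hu12|split; [|exact Hbc]].
    (* Within the bounds the projection is the identity, so [F] and [f] agree along the solution. *)
    intros t Ht; replace (f t (u t) (u1 t) (u2 t)) with (F t (u t) (u1 t) (u2 t));
      [now apply Hder|].
    destruct (Hbounds t ltac:(lra)) as [H0 [H1 H2]]; apply Rabs_le_between in H2.
    unfold F, cx, cy, cz; rewrite !clamp_id by lra.
    now rewrite <- Rmult_assoc, Hsg2, Rmult_1_l.
  - destruct Hsg as [E|E]; [left|right]; auto.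
Qed.
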